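(* Let $p$ be an exponent and assume that the elliptic extension statement $\mathcal R^*(p\to q)$ holds for some $q$ greater than the maximum of $\frac{(d+2)p'}d$ and $\frac{2(d+1)}d$. Define $\tilde p$ by $\tilde p':=\frac{dq}{d+2}$. Then for all bounded sets $K\subseteq\mathbb R^d$, all even polynomials $P$ with non-negative coefficients, and all $\alpha<\frac d{\tilde p}-\frac dp$, $$\|\Lambda_P(\nabla)^{1/\tilde p'}\mathcal E_P(\chi_Kf)\|_{L^q(\mathbb R^{1+d})}\le C\,\||\xi|^\alpha f\|_{L^p(\mathbb R^d)}.$$ The constant $C$ depends on $K$, $\alpha$, and the degree of $P$ (as well as on $d,p,q$ and the constants in $\mathcal R^*(p\to q)$), but not otherwise on $P$.
   Context: Here $d$ is a positive integer and $p'$ is the exponent dual to $p$. The extension operator is $$\mathcal E_Pf(t,x)=\int_{\mathbb R^d}e^{i(tP(|\xi|)+x\cdot\xi)}f(\xi)\,d\xi,$$ $\Lambda_P(\xi):=|\det D^2_\xi[P(|\xi|)]|^{\frac1{d+2}}$, and $\Lambda_P(\nabla)^s$ denotes the spatial Fourier multiplier operator with symbol $\Lambda_P(\xi)^s$, so that $\Lambda_P(\nabla)^s\mathcal E_Pf=\mathcal E_P(\Lambda_P^sf)$. $\chi_K$ is the indicator function of $K$. Elliptic phases: let $B$ be the unit ball of $\mathbb R^d$. A phase $\Phi$ is elliptic on $U\subseteq B$ with parameters $A,N,\epsilon_0$ ($0<\epsilon_0<1$) if $\|\nabla \Phi\|_{C^N(B)}\le A$ and all eigenvalues of $D^2\Phi(x)$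 lie in $(\epsilon_0,\epsilon_0^{-1})$ for all $x\in U$. The statement $\mathcal R^*(p\to q)$ (equivalent by duality to the elliptic restriction estimate from $L^{q'}$ to $L^{p'}$): there exists $N$ such that for all $A,\epsilon_0$ there is a constant $C$ such that for every phase $\Phi$ elliptic on $U\subseteq B$ with parameters $A,N,\epsilon_0$, $$\Bigl\|\int_Ue^{i(t\Phi(\xi)+x\cdot\xi)}f(\xi)\,d\xi\Bigr\|_{L^q_{t,x}(\mathbb R^{1+d})}\le C\|f\|_{L^p(U)}.$$ *)

(* Defs.v *)
From HB Require Import structures.
From mathcomp Require Import all_boot all_order all_algebra complex.
From mathcomp Require Import all_classical all_reals all_analysis.
Set Implicit Arguments.
Unset Strict Implicit.
Unset Printing Implicit Defensive.
Import Order.TTheory GRing.Theory Num.Theory.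
Import numFieldNormedType.Exports.

Local Open Scope classical_set_scope.
Local Open Scope ring_scope.
Local Open Scope complex_scope.

(* ['rV[R]_d] carries the sigma-algebra generated by the coordinates, exactly
   as the library does for [d.-tuple R]; it is the Borel sigma-algebra. *)
Section measurable_rV.
Context {R : realType} (d : nat).

Let coors : 'I_d -> 'rV[R]_d -> measurableTypeR R := fun i x => x ord0 i.

Let rV_set0 : g_sigma_preimage coors set0.
Proof. exact: sigma_algebra0. Qed.

Let rV_setC A : g_sigma_preimage coors A -> g_sigma_preimage coors (~` A).
Proof. exact: sigma_algebraC. Qed.

Let rV_bigcup (F : _^nat) : (forall i, g_sigma_preimage coors (F i)) ->
  g_sigma_preimage coors (\bigcup_i (F i)).
Proof. exact: sigma_algebra_bigcup. Qed.

HB.instance Definition _ := @isMeasurable.Build default_measure_display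
  'rV[R]_d (g_sigma_preimage coors) rV_set0 rV_setC rV_bigcup.

End measurable_rV.

Section lebesgue_rV.
Context {R : realType}.

Definition rV_cons d (z : measurableTypeR R * 'rV[R]_d) : 'rV[R]_d.+1 :=
  \row_i oapp (z.2 ord0) z.1 (unlift ord0 i).

Definition rV_uncons d (x : 'rV[R]_d.+1) : measurableTypeR R * 'rV[R]_d :=
  (x ord0 ord0, \row_i x ord0 (lift ord0 i)).

Lemma rV_consK d : cancel (@rV_cons d) (@rV_uncons d).
Proof.
move=> [a v]; rewrite /rV_uncons; congr pair; first by rewrite mxE unlift_none.
by apply/rowP => i; rewrite !mxE liftK.
Qed.

Lemma rV_unconsK d : cancel (@rV_uncons d) (@rV_cons d).
Proof.
by move=> x; apply/rowP => i; rewrite mxE; case: unliftP => [j|] -> //=; rewrite mxE.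
Qed.

Lemma measurable_coord d (i : 'I_d) :
  measurable_fun [set: 'rV[R]_d] (fun x : 'rV[R]_d => x ord0 i).
Proof.
move=> _ Y mY; rewrite setTI; apply: sub_sigma_algebra => /=.
rewrite -bigcup_seq/=; exists i => /=; first by rewrite mem_index_enum.
by exists Y => //; rewrite setTI.
Qed.

Lemma measurable_fun_rVP d' (T : measurableType d') d (f : T -> 'rV[R]_d) :
  (forall i, measurable_fun [set: T] (fun x => f x ord0 i : measurableTypeR R)) ->
  measurable_fun [set: T] f.
Proof.
move=> mf _ A mA.
suff : preimage_set_system [set: T] f measurable `<=` measurable.
  by apply; exists A.
rewrite [X in preimage_set_system _ _ X](_ : _ = g_sigma_preimage
  (fun i (x : 'rV[R]_d) => x ord0 i : measurableTypeR R))//.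
rewrite -g_sigma_preimage_comp.
apply: smallest_sub; first exact: sigma_algebra_measurable.
rewrite -bigcup_seq/=; apply: bigcup_sub => i _ B [C mC <-].
exact: mf.
Qed.

Lemma measurable_rV_cons d : measurable_fun setT (@rV_cons d).
Proof.
apply: measurable_fun_rVP => i.
case: (unliftP ord0 i) => [j|] ->.
  apply: (@eq_measurable_fun _ _ _ _ setT
    (fun z : measurableTypeR R * 'rV[R]_d => z.2 ord0 j)).
    by move=> z _; rewrite mxE liftK.
  exact: (measurableT_comp (measurable_coord j) measurable_snd).
apply: (@eq_measurable_fun _ _ _ _ setT
  (fun z : measurableTypeR R * 'rV[R]_d => z.1)).
  by move=> z _; rewrite mxE unlift_none.
exact: measurable_fst.
Qed.

Lemma measurable_rV_uncons d : measurable_fun setT (@rV_uncons d).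
Proof.
apply/measurable_fun_pairP; split; first exact: measurable_coord.
apply: measurable_fun_rVP => i.
apply: (@eq_measurable_fun _ _ _ _ setT
  (fun x : 'rV[R]_d.+1 => x ord0 (lift ord0 i))).
  by move=> x _; rewrite /= mxE.
exact: measurable_coord.
Qed.

Section step.
Variables (d : nat) (mu : {sigma_finite_measure set 'rV[R]_d -> \bar R}).

Definition lebesgue_rV_step : set 'rV[R]_d.+1 -> \bar R :=
  pushforward (lebesgue_measure \x mu)%E (@rV_cons d).

Let step0 : lebesgue_rV_step set0 = 0%E.
Proof. by rewrite /lebesgue_rV_step /pushforward preimage_set0 measure0. Qed.

Let step_ge0 A : (0 <= lebesgue_rV_step A)%E.
Proof. by rewrite /lebesgue_rV_step /pushforward measure_ge0. Qed.

Let step_sigma_additive : semi_sigma_additive lebesgue_rV_step.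
Proof.
pose pm := measure_function_pushforward__canonical__measure_function_Measure
  (lebesgue_measure \x mu)%E (@measurable_rV_cons d).
exact: (@measure_semi_sigma_additive _ _ _ pm).
Qed.

HB.instance Definition _ := isMeasure.Build _ _ _ lebesgue_rV_step
  step0 step_ge0 step_sigma_additive.

Let step_sigma_finite : sigma_finite setT lebesgue_rV_step.
Proof.
have /sigma_finiteP[F [TF ndF Foo]] := sigma_finiteT (@lebesgue_measure R).
have /sigma_finiteP[G [TG ndG Goo]] := sigma_finiteT mu.
exists (fun n => @rV_uncons d @^-1` (F n `*` G n)).
  apply/seteqP; split=> [x _|//].
  have [n _ Fn] : (\bigcup_i F i) (rV_uncons x).1 by rewrite -TF.
  have [k _ Gk] : (\bigcup_i G i) (rV_uncons x).2 by rewrite -TG.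
  exists (maxn n k) => //; split.
  - by move: Fn; exact/subsetPset/ndF/leq_maxl.
  - by move: Gk; exact/subsetPset/ndG/leq_maxr.
move=> k; have [mF Foo_k] := Foo k; have [mG Goo_k] := Goo k; split.
  rewrite -[X in measurable X]setTI; apply: measurable_rV_uncons => //.
  exact: measurableX.
rewrite /lebesgue_rV_step /pushforward -comp_preimage.
rewrite (_ : _ \o _ = id); last by apply/funext => z; exact: rV_consK.
by rewrite preimage_id product_measure1E// lte_mul_pinfty// ge0_fin_numE.
Qed.

HB.instance Definition _ := Measure_isSigmaFinite.Build _ _ _
  lebesgue_rV_step step_sigma_finite.

End step.

Fixpoint lebesgue_rV (d : nat) : {sigma_finite_measure set 'rV[R]_d -> \bar R} :=
  match d with
  | 0 => [the {sigma_finite_measure set 'rV[R]_0 -> \bar R} of \d_(0 : 'rV[R]_0)]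
  | d'.+1 => [the {sigma_finite_measure set 'rV[R]_d'.+1 -> \bar R} of
      lebesgue_rV_step (lebesgue_rV d')]
  end.

Lemma lebesgue_rV_box d (A : 'I_d -> set (measurableTypeR R)) :
  (forall i, measurable (A i)) ->
  lebesgue_rV d [set x | forall i, A i (x ord0 i)] =
  (\prod_(i < d) lebesgue_measure (A i))%E.
Proof.
elim: d A => [|d IH] A mA /=.
  by rewrite big_ord0 diracE mem_set// => -[].
have mbox : measurable [set x : 'rV[R]_d | forall i, A (lift ord0 i) (x ord0 i)].
  rewrite (_ : [set _ | _] =
      \big[setI/setT]_(i < d) [set x : 'rV[R]_d | A (lift ord0 i) (x ord0 i)]).
    apply: bigsetI_measurable => i _.
    by rewrite -[X in measurable X]setTI; apply: (measurable_coord i) => //; exact: mA.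
  apply/seteqP; split=> x /=; rewrite -bigcap_seq/= => xA i.
    by move=> _; exact: xA.
  by apply: xA; rewrite /= mem_index_enum.
rewrite big_ord_recl -IH; last by move=> i; exact: mA.
rewrite -product_measure1E//; congr (product_measure1 _ _ _).
apply/seteqP; split=> -[a v] /=.
  move=> H; split; first by have := H ord0; rewrite mxE unlift_none.
  by move=> i; have := H (lift ord0 i); rewrite mxE liftK.
by move=> [Aa Av] i; rewrite mxE; case: unliftP => [j ->|->] //=; exact: Av.
Qed.

End lebesgue_rV.

Section complex_integral.
Context {R : realType} d {T : measurableType d}.
Variable mu : {measure set T -> \bar R}.

Definition cmeasurable_fun (D : set T) (f : T -> R[i]) :=
  measurable_fun D (fun x => complex.Re (f x)) /\ measurable_fun D (fun x => complex.Im (f x)).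

Definition cintegrable (D : set T) (f : T -> R[i]) :=
  mu.-integrable D (fun x => (complex.Re (f x))%:E) /\
  mu.-integrable D (fun x => (complex.Im (f x))%:E).

Definition cintegral (D : set T) (f : T -> R[i]) : R[i] :=
  Rintegral mu D (fun x => complex.Re (f x)) +i* Rintegral mu D (fun x => complex.Im (f x)).

Definition cLnorm (p : \bar R) (f : T -> R[i]) : \bar R :=
  Lnorm mu p (fun x => (Normc.normc (f x))%:E).

End complex_integral.

Section euclidean.
Context {R : realType} {d : nat}.
Implicit Types (x y xi : 'rV[R]_d) (f : 'rV[R]_d -> R).

Definition dotp x y : R := \sum_(i < d) x ord0 i * y ord0 i.

(* The norm [`|x|] which the library puts on ['rV[R]_d] is the sup norm. *)
Definition enorm x : R := Num.sqrt (dotp x x).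

Definition unit_ball : set 'rV[R]_d := [set x | enorm x < 1].

Definition partial (i : 'I_d) f : 'rV[R]_d -> R := 'D_(delta_mx ord0 i) f.

Definition partials (s : seq 'I_d) f : 'rV[R]_d -> R := foldr partial f s.

Definition hessian f x : 'M[R]_d := \matrix_(i, j) partial i (partial j f) x.

(* [f] is of class C^k on the open set [B]. *)
Definition Ck (k : nat) (B : set 'rV[R]_d) f :=
  forall s : seq 'I_d, (size s <= k)%N ->
    (forall x, B x -> {for x, continuous (partials s f)}) /\
    ((size s < k)%N ->
      forall x i, B x -> derivable (partials s f) x (delta_mx ord0 i)).

(* || \nabla f ||_{C^N(B)}: the partial derivatives of order at most [N] of the
   components of the gradient are those of [f] of order 1 to [N + 1]. *)
Definition grad_CN_norm (N : nat) (B : set 'rV[R]_d) f : \bar R :=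
  ereal_sup [set `|partials s f x|%:E |
    s in [set s : seq 'I_d | (1 <= size s <= N.+1)%N] & x in B].

(* The Hessian is symmetric on [U], so real eigenvalues are all eigenvalues
   (for [N = 0] the Hessian may fail to exist, but the condition only gets
   stronger as [N] grows and [N] is existentially quantified below). *)
Definition elliptic_phase (A : R) (N : nat) (eps0 : R) (U : set 'rV[R]_d)
    (Phi : 'rV[R]_d -> R) :=
  [/\ Ck N.+1 unit_ball Phi,
      (grad_CN_norm N unit_ball Phi <= A%:E)%E &
      forall x, U x -> forall a, eigenvalue (hessian Phi x) a ->
        eps0 < a < eps0^-1].

Definition expi (theta : R) : R[i] := cos theta +i* sin theta.

(* \int_U e^{i (t Phi(xi) + x . xi)} f(xi) dxi *)
Definition extension (U : set 'rV[R]_d) (Phi : 'rV[R]_d -> R)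
    (f : 'rV[R]_d -> R[i]) (tx : measurableTypeR R * 'rV[R]_d) : R[i] :=
  cintegral (lebesgue_rV d) U
    (fun xi => expi (tx.1 * Phi xi + dotp tx.2 xi) * f xi).

Definition rmul (w : 'rV[R]_d -> R) (f : 'rV[R]_d -> R[i]) : 'rV[R]_d -> R[i] :=
  fun xi => (w xi)%:C * f xi.

Definition radial_phase (P : {poly R}) : 'rV[R]_d -> R := fun xi => P.[enorm xi].

Definition Lambda (P : {poly R}) xi : R :=
  `|\det (hessian (radial_phase P) xi)| `^ d.+2%:R^-1.

Definition inv_fourier (g : 'rV[R]_d -> R[i]) x : R[i] :=
  cintegral (lebesgue_rV d) setT (fun xi => expi (dotp x xi) * g xi).

(* [v] is the image of [u] under the Fourier multiplier operator with symbol
   [m], for [u] the inverse Fourier transform of an integrable function. The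
   normalization of the Fourier transform plays no role. By injectivity of the
   Fourier transform, [g] is determined by [u] up to a null set, hence so is
   [v]. *)
Definition fourier_multiplier (m : 'rV[R]_d -> R) (u v : 'rV[R]_d -> R[i]) :=
  exists g : 'rV[R]_d -> R[i],
    [/\ cintegrable (lebesgue_rV d) setT g,
        cintegrable (lebesgue_rV d) setT (rmul m g),
        u =1 inv_fourier g &
        v =1 inv_fourier (rmul m g)].

End euclidean.

Definition spacetime_measure (R : realType) (d : nat) :
    {measure set (measurableTypeR R * 'rV[R]_d) -> \bar R} :=
  (lebesgue_measure \x lebesgue_rV d)%E.

(* The statement R^*(p -> q). Since [C] is positive, the inequality is void when
   [f] is not in L^p(U); otherwise the integrand is integrable as [U] is
   bounded. *)
Definition elliptic_extension (R : realType) (d : nat) (p q : \bar R) :=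
  exists N : nat, forall A eps0 : R, 0 < eps0 < 1 ->
  exists C : R, 0 < C /\
    forall (U : set 'rV[R]_d) (Phi : 'rV[R]_d -> R),
      measurable U -> U `<=` unit_ball -> elliptic_phase A N eps0 U Phi ->
    forall f : 'rV[R]_d -> R[i], cmeasurable_fun U f ->
      (cLnorm (spacetime_measure R d) q (extension U Phi f)
        <= C%:E * cLnorm (lebesgue_rV d) p (rmul \1_U f))%E.

(* Main.v *)
(* Decompose the frequency space into the dyadic annuli |xi| ~ lambda. Writing
   P(r) = S(r^2), the coefficients of S are nonnegative, so on such an annulus
   all the derivatives of the phase are controlled by the single number
   M = S(lambda^2) - S(0): rescaling the annulus to unit size and dividing the
   phase by M gives a phase which is elliptic uniformly in P, while
   Lambda_P^(d+2) <= C (M / lambda^2)^d. In the rescaled elliptic extension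
   estimate the powers of M cancel exactly because Lambda_P has exponent
   (d+2)/(dq), and what is left is lambda^(d/pt - d/p - alpha) times the weighted
   L^p norm. This is summable over the annuli that meet K, so the triangle
   inequality in L^q concludes. When q = oo the multiplier is trivial, and the
   same dyadic sum of Hoelder's inequality bounds the L^1 norm of chi_K f. *)
Require Import Defs.
From mathcomp Require Import all_boot all_order all_algebra complex.
From mathcomp Require Import all_classical all_reals all_analysis.
From mathcomp Require Import perm ess_sup_inf measurable_realfun ring lra zify.
Import Order.TTheory GRing.Theory Num.Theory.
Import numFieldNormedType.Exports.
Local Open Scope classical_set_scope.
Local Open Scope ring_scope.
Local Open Scope complex_scope.
Set Implicit Arguments.
Unset Strict Implicit.
Unset Printing Implicit Defensive.

(** * Polynomial functions *)

(** Passing to [S] in the variable |xi|^2 does two jobs. [enorm] is not differentiable at the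
    origin, whereas [elliptic_phase] asks for derivative bounds on the whole unit ball; S(|x|^2) is
    a polynomial in the coordinates. Moreover its Hessian is 2 S' I + 4 S'' x^T x, with spectrum
    between 2 S' and 2 S' + 4 S'' |x|^2, and nonnegative coefficients make both ends comparable, on
    the reference annulus, to the mass of the nonconstant terms, with constants depending on the
    degree alone.

    The exponent of lambda is d/pt - d/p - alpha because 1/pt = 1 - (d+2)/(dq), that is d/pt = d -
    (d+2)/q: the frequency Jacobian gives d, the spatial dilation -d/q, the bound on Lambda_P -2/q.

    Since d/pt <= d, the condition on alpha also makes chi_K f integrable whenever the right-hand
    side is finite. Hence the extension is at every point the sum of its annular pieces, no density
    argument is required, and the Fourier multiplier acts on the inverse transform of a genuine L^1
    function. *)

Section polynomial_functions.
Context {R : realType} {d : nat}.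
Implicit Types (f g : 'rV[R]_d -> R) (x v : 'rV[R]_d) (S : {poly R}).

(** This class is closed under partial derivatives and determinants, and its members are continuous,
    measurable and bounded on boxes; each regularity fact about the phase and its Hessian
    determinant is one induction. *)
Inductive polyfun : ('rV[R]_d -> R) -> Prop :=
| polyfun_cst c : polyfun (fun=> c)
| polyfun_coord i : polyfun (fun x => x ord0 i)
| polyfunD f g : polyfun f -> polyfun g -> polyfun (fun x => f x + g x)
| polyfunM f g : polyfun f -> polyfun g -> polyfun (fun x => f x * g x).

Lemma polyfun_sum (I : Type) (r : seq I) (F : I -> 'rV[R]_d -> R) :
  (forall i, polyfun (F i)) -> polyfun (fun x => \sum_(i <- r) F i x).
Proof.
move=> pF; elim: r => [|i r IH].
  by rewrite (_ : (fun _ => _) = fun=> 0); [exact: polyfun_cst|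
    apply/funext => x; rewrite big_nil].
rewrite (_ : (fun _ => _) = fun x => F i x + \sum_(i <- r) F i x).
  exact: polyfunD.
by apply/funext => x; rewrite big_cons.
Qed.

Lemma polyfun_prod (I : Type) (r : seq I) (F : I -> 'rV[R]_d -> R) :
  (forall i, polyfun (F i)) -> polyfun (fun x => \prod_(i <- r) F i x).
Proof.
move=> pF; elim: r => [|i r IH].
  by rewrite (_ : (fun _ => _) = fun=> 1); [exact: polyfun_cst|
    apply/funext => x; rewrite big_nil].
rewrite (_ : (fun _ => _) = fun x => F i x * \prod_(i <- r) F i x).
  exact: polyfunM.
by apply/funext => x; rewrite big_cons.
Qed.

Lemma polyfun_dotp : polyfun (fun x => dotp x x).
Proof. by apply: polyfun_sum => i; apply: polyfunM; exact: polyfun_coord. Qed.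

Lemma polyfun_horner S f : polyfun f -> polyfun (fun x => S.[f x]).
Proof.
move=> pf; elim/poly_ind: S => [|S c IH].
  rewrite (_ : (fun _ => _) = fun=> 0); first exact: polyfun_cst.
  by apply/funext => x; rewrite horner0.
rewrite (_ : (fun _ => _) = fun x => S.[f x] * f x + c).
  by apply: polyfunD; [exact: polyfunM|exact: polyfun_cst].
by apply/funext => x; rewrite hornerMXaddC.
Qed.

Lemma polyfun_det m (A : 'rV[R]_d -> 'M[R]_m) :
  (forall i j, polyfun (fun x => A x i j)) -> polyfun (fun x => \det (A x)).
Proof.
move=> pA; apply: polyfun_sum => s; apply: polyfunM; first exact: polyfun_cst.
by apply: polyfun_prod.
Qed.

Lemma polyfun_continuous f : polyfun f -> continuous f.
Proof.
elim=> [c|i|{}f g _ cf _ cg|{}f g _ cf _ cg] x.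
- exact: cst_continuous.
- exact: coord_continuous.
- by apply: continuousD; [exact: cf|exact: cg].
- by apply: continuousM; [exact: cf|exact: cg].
Qed.

Lemma polyfun_measurable f : polyfun f -> measurable_fun setT f.
Proof.
elim=> [c|i|{}f g _ mf _ mg|{}f g _ mf _ mg].
- exact: measurable_cst.
- exact: measurable_coord.
- exact: measurable_funD.
- exact: measurable_funM.
Qed.

Lemma polyfun_bounded f (r : R) : polyfun f ->
  exists2 c, 0 < c & forall x, (forall i, `|x ord0 i| <= r) -> `|f x| <= c.
Proof.
elim=> [c|i|{}f g _ [a a0 fa] _ [b b0 gb]|{}f g _ [a a0 fa] _ [b b0 gb]].
- by exists (`|c| + 1) => [|x _]; rewrite ?ltr_pwDr// lerDl.
- exists (`|r| + 1) => [|x xr]; first by rewrite ltr_pwDr.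
  by rewrite (le_trans (xr i))// (le_trans (ler_norm _))// lerDl.
- exists (a + b) => [|x xr]; first exact: addr_gt0.
  by rewrite (le_trans (ler_normD _ _))// lerD// ?fa// gb.
- exists (a * b) => [|x xr]; first exact: mulr_gt0.
  by rewrite normrM ler_pM// ?fa// gb.
Qed.

Lemma is_derive_coord x v i : is_derive x v (fun y : 'rV[R]_d => y ord0 i) (v ord0 i).
Proof.
have dv : derivable (@id 'rV[R]_d) x v by exact: derivable_id.
have /derivable_mxP dc := dv.
apply: DeriveDef => //.
by have := derive_mx dv; rewrite derive_id => /matrixP/(_ ord0 i); rewrite mxE.
Qed.

Lemma polyfun_is_derive f (i : 'I_d) : polyfun f ->
  exists2 g, polyfun g & forall x, is_derive x (delta_mx ord0 i) f (g x).
Proof.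
elim=> [c|j|{}f1 f2 pf1 [g1 pg1 dg1] pf2 [g2 pg2 dg2]|{}f1 f2 pf1 [g1 pg1 dg1] pf2 [g2 pg2 dg2]].
- by exists (fun=> 0) => [|x]; [exact: polyfun_cst|exact: is_derive_cst].
- exists (fun=> (delta_mx ord0 i : 'rV[R]_d) ord0 j) => [|x].
    exact: polyfun_cst.
  exact: is_derive_coord.
- by exists (fun x => g1 x + g2 x) => [|x]; [exact: polyfunD|exact: is_deriveD].
- exists (fun x => f1 x * g2 x + f2 x * g1 x) => [|x].
    by apply: polyfunD; exact: polyfunM.
  exact: is_deriveM.
Qed.

Lemma polyfun_derivable f x (i : 'I_d) : polyfun f -> derivable f x (delta_mx ord0 i).
Proof. by move=> /(polyfun_is_derive i)[g _ dg]; exact: (@ex_derive _ _ _ _ _ _ _ (dg x)). Qed.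

Lemma partialE f g i :
  (forall x, is_derive x (delta_mx ord0 i) f (g x)) -> partial i f = g.
Proof. by move=> dg; apply/funext => x; rewrite /partial; exact: (@derive_val _ _ _ _ _ _ _ (dg x)). Qed.

Lemma polyfun_partial f i : polyfun f -> polyfun (partial i f).
Proof. by move=> /(polyfun_is_derive i)[g pg /partialE ->]. Qed.

Lemma polyfun_partials f s : polyfun f -> polyfun (partials s f).
Proof. by move=> pf; elim: s => //= i s; exact: polyfun_partial. Qed.

Lemma polyfun_Ck f k (B : set 'rV[R]_d) : polyfun f -> Ck k B f.
Proof.
move=> pf s _; split=> [x _|_ x i _].
  exact/polyfun_continuous/polyfun_partials.
exact/polyfun_derivable/polyfun_partials.
Qed.

(** Expanding S(|x|^2) in powers of |x|^2 reduces its derivatives to those of finitely many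
    functions that do not depend on [S]. *)
Lemma partials_lincomb n (b : 'I_n -> R) (F : 'I_n -> 'rV[R]_d -> R) s :
  (forall j, polyfun (F j)) ->
  partials s (fun x => \sum_(j < n) b j * F j x) =
  (fun x => \sum_(j < n) b j * partials s (F j) x).
Proof.
move=> pF; elim: s => //= i s ->; apply: partialE => x.
rewrite (_ : (fun _ => _) = \sum_(j < n) (b j \*: partials s (F j))).
  apply: (@is_derive_sum _ _ _ n (fun j => b j \*: partials s (F j)) x _
    (fun j => b j * partial i (partials s (F j)) x)) => j.
  by apply: is_deriveZ; apply: derivableP; exact/polyfun_derivable/polyfun_partials.
by apply/funext => y; rewrite fct_sumE.
Qed.

Lemma partials_cst (c : R) (s : seq 'I_d) :
  s != [::] -> partials s (fun=> c) = fun=> 0.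
Proof.
elim: s => // i [_ _|j s IH _] /=; first by apply: partialE => x; exact: is_derive_cst.
by move: (IH isT) => /= ->; apply: partialE => x; exact: is_derive_cst.
Qed.

Lemma is_derive_horner S f x v (df : R) : is_derive x v f df ->
  is_derive x v (fun y => S.[f y]) (S^`().[f x] * df).
Proof.
move=> Df; elim/poly_ind: S => [|S c IH].
  rewrite deriv0 horner0 mul0r (_ : (fun _ => _) = cst 0).
    exact: is_derive_cst.
  by apply/funext => y; rewrite horner0.
rewrite (_ : (fun y => _) = (fun y => S.[f y]) * f + cst c).
  apply: is_derive_eq.
  by rewrite derivMXaddC hornerD hornerMX /GRing.scale /=; ring.
by apply/funext => y; rewrite hornerMXaddC.
Qed.

Lemma is_derive_dotp x i :
  is_derive x (delta_mx ord0 i) (fun y => dotp y y) (2 * x ord0 i).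
Proof.
rewrite (_ : (fun y => _) =
    \sum_(j < d) ((fun y : 'rV[R]_d => y ord0 j) * (fun y : 'rV[R]_d => y ord0 j))).
  rewrite (_ : 2 * _ = \sum_(j < d) (x ord0 j *: (delta_mx ord0 i : 'rV[R]_d) ord0 j
    + x ord0 j *: (delta_mx ord0 i : 'rV[R]_d) ord0 j)).
    apply: is_derive_sum => j; apply: is_deriveM; exact: is_derive_coord.
  rewrite (bigD1 i)//= big1 ?addr0 => [|j ji].
    by rewrite mxE !eqxx /GRing.scale /= mulr1 mulr2n mulrDl mul1r.
  by rewrite mxE (negbTE ji) andbF !scaler0 addr0.
by apply/funext => y; rewrite fct_sumE.
Qed.

Lemma partial_radial S i : partial i (fun x => S.[dotp x x]) =
  (fun x => S^`().[dotp x x] * (2 * x ord0 i)).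
Proof. by apply: partialE => x; apply: is_derive_horner; exact: is_derive_dotp. Qed.

Lemma hessian_radial S x i j : hessian (fun x => S.[dotp x x]) x i j =
  2 * S^`().[dotp x x] * (i == j)%:R +
  4 * S^`()^`().[dotp x x] * (x ord0 i * x ord0 j).
Proof.
rewrite mxE partial_radial.
have -> : (fun x => S^`().[dotp x x] * (2 * x ord0 j)) =
  (fun x => S^`().[dotp x x]) * (2 \*: (fun x : 'rV[R]_d => x ord0 j)) by [].
have -> : partial i ((fun x => S^`().[dotp x x]) *
    (2 \*: (fun x : 'rV[R]_d => x ord0 j))) =
  (fun x => S^`().[dotp x x] * (2 * (i == j)%:R) +
   2 * x ord0 j * (S^`()^`().[dotp x x] * (2 * x ord0 i))); last by ring.
apply: partialE => y; apply: is_deriveM.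
  by apply: is_derive_horner; exact: is_derive_dotp.
apply: is_deriveZ.
have -> : (i == j)%:R = (delta_mx ord0 i : 'rV[R]_d) ord0 j.
  by rewrite mxE eqxx eq_sym.
exact: is_derive_coord.
Qed.

End polynomial_functions.

(** * Euclidean norm and inner product *)

Section euclidean_norm.
Context {R : realType} {d : nat}.
Implicit Types (x v : 'rV[R]_d).

Lemma dotp_ge0 x : 0 <= dotp x x.
Proof. by apply: sumr_ge0 => i _; rewrite -expr2 sqr_ge0. Qed.

Lemma enorm_ge0 x : 0 <= enorm x.
Proof. exact: sqrtr_ge0. Qed.

Lemma sqr_enorm x : enorm x ^+ 2 = dotp x x.
Proof. by rewrite sqr_sqrtr// dotp_ge0. Qed.

Lemma dotpZ (a : R) x : dotp (a *: x) (a *: x) = a ^+ 2 * dotp x x.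
Proof. by rewrite /dotp mulr_sumr; apply: eq_bigr => i _; rewrite !mxE; ring. Qed.

Lemma enormZ (a : R) x : 0 <= a -> enorm (a *: x) = a * enorm x.
Proof. by move=> a0; rewrite /enorm dotpZ sqrtrM ?sqr_ge0// sqrtr_sqr ger0_norm. Qed.

Lemma coord_le_enorm x i : `|x ord0 i| <= enorm x.
Proof.
rewrite -sqrtr_sqr ler_sqrt ?dotp_ge0// /dotp (bigD1 i)//= -expr2 lerDl.
by apply: sumr_ge0 => j _; rewrite -expr2 sqr_ge0.
Qed.

Lemma dotp_gt0 x : x != 0 -> 0 < dotp x x.
Proof.
move=> /rV0Pn[i xi0]; rewrite /dotp (bigD1 i)//= ltr_pwDl//.
  by rewrite -expr2 exprn_even_gt0.
by apply: sumr_ge0 => j _; rewrite -expr2 sqr_ge0.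
Qed.

Lemma enorm_gt0 x : x != 0 -> 0 < enorm x.
Proof. by move=> x0; rewrite sqrtr_gt0 dotp_gt0. Qed.

Lemma enorm0 : enorm (0 : 'rV[R]_d) = 0.
Proof. by rewrite /enorm /dotp big1 ?sqrtr0// => i _; rewrite mxE mul0r. Qed.

(** Boundedness of [K] is expressed in the sup norm; this converts it. The crude constant avoids a
    square root, through d <= (d+1)^2. *)
Lemma enorm_le_norm x : enorm x <= d.+1%:R * `|x|.
Proof.
rewrite -[leRHS]ger0_norm ?mulr_ge0// -sqrtr_sqr ler_sqrt ?sqr_ge0//.
rewrite exprMn (@le_trans _ _ (\sum_(i < d) `|x| ^+ 2))//.
  apply: ler_sum => i _; rewrite -expr2 -[leLHS]real_normK ?num_real//.
  rewrite ler_sqr ?nnegrE//.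
  have -> : `|x| = mx_norm x by [].
  rewrite mx_normrE.
  exact: (le_bigmax _ (fun ij : 'I_1 * 'I_d => `|x ij.1 ij.2|) (ord0, i)).
rewrite sumr_const card_ord -[leLHS]mulr_natl ler_wpM2r ?sqr_ge0//.
by rewrite -natrX ler_nat; apply: leq_trans (leqnSn d) _; rewrite expnS expn1 leq_pmulr.
Qed.

Lemma measurable_enorm : measurable_fun setT (@enorm R d).
Proof.
apply: (@measurableT_comp _ _ _ _ _ _ (@Num.sqrt R)).
  by apply: continuous_measurable_fun; exact: sqrt_continuous.
by apply: polyfun_measurable; exact: polyfun_dotp.
Qed.

(* Cauchy-Schwarz, from [0 <= dotp (v - t x) (v - t x)] at the minimizing [t]. *)
Lemma sqr_dotp_le v x : dotp v x ^+ 2 <= dotp v v * dotp x x.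
Proof.
have [->|x0] := eqVneq x 0.
  rewrite {1}/dotp big1 ?expr0n /= ?mulr_ge0 ?dotp_ge0// => i _.
  by rewrite mxE mulr0.
have xx := dotp_gt0 x0; set t := dotp v x / dotp x x.
have : 0 <= dotp v v - 2 * t * dotp v x + t ^+ 2 * dotp x x.
  have -> : dotp v v - 2 * t * dotp v x + t ^+ 2 * dotp x x =
      dotp (v - t *: x) (v - t *: x).
    rewrite /dotp !mulr_sumr -sumrB -big_split /=.
    by apply: eq_bigr => i _; rewrite !mxE; ring.
  exact: dotp_ge0.
rewrite (_ : _ + _ = (dotp v v * dotp x x - dotp v x ^+ 2) / dotp x x).
  by rewrite pmulr_lge0 ?invr_gt0// subr_ge0.
by rewrite /t; field; rewrite gt_eqF.
Qed.

End euclidean_norm.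

(** * Spectrum of the Hessian of a radial polynomial *)

Section radial_hessian.
Context {R : realType} {d : nat}.
Implicit Types (x v : 'rV[R]_d) (S : {poly R}).

Lemma deriv_horner_sum S (r : R) :
  S^`().[r] = \sum_(j < size S) S`_j * (j%:R * r ^+ j.-1).
Proof.
rewrite -[in LHS](coefK S) poly_def linear_sum /= horner_sum.
apply: eq_bigr => j _.
by rewrite derivZ derivXn hornerZ hornerMn hornerXn mulr_natl.
Qed.

Lemma deriv2_horner_sum S (r : R) :
  S^`()^`().[r] = \sum_(j < size S) S`_j * (j%:R * (j.-1%:R * r ^+ j.-2)).
Proof.
rewrite -[in LHS](coefK S) poly_def !linear_sum /= horner_sum.
apply: eq_bigr => j _.
by rewrite !derivZ derivXn derivMn derivXn hornerZ !hornerMn hornerXn !mulr_natl.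
Qed.

Lemma quadratic_form_radial_hessian S x v :
  dotp (v *m hessian (fun y => S.[dotp y y]) x) v =
  2 * S^`().[dotp x x] * dotp v v + 4 * S^`()^`().[dotp x x] * dotp v x ^+ 2.
Proof.
transitivity (\sum_(j < d) (2 * S^`().[dotp x x] * (v ord0 j * v ord0 j) +
    4 * S^`()^`().[dotp x x] * dotp v x * (v ord0 j * x ord0 j))); last first.
  by rewrite big_split /= -!mulr_sumr expr2 mulrA.
apply: eq_bigr => j _; rewrite mxE.
rewrite (eq_bigr (fun i => v ord0 i * (2 * S^`().[dotp x x] * (i == j)%:R) +
    v ord0 i * (4 * S^`()^`().[dotp x x] * (x ord0 i * x ord0 j)))); last first.
  by move=> i _; rewrite -mulrDr; congr (_ * _); exact: hessian_radial.
rewrite big_split /= (bigD1 j)//= eqxx big1 ?addr0 => [|i ij]; last first.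
  by rewrite (negbTE ij) !mulr0.
rewrite mulrDl; congr (_ + _); first by rewrite mulr1; ring.
rewrite [dotp v x]/dotp mulr_sumr !mulr_suml; apply: eq_bigr => i _; ring.
Qed.

(** Pairing the eigenvector equation with [v] makes [a] a Rayleigh quotient, and Cauchy-Schwarz
    controls the rank-one term. The two ends are the values on vectors orthogonal and parallel to
    [x]. *)
Lemma radial_eigenvalue S x (a : R) : 0 <= S^`()^`().[dotp x x] ->
  eigenvalue (hessian (fun y => S.[dotp y y]) x) a ->
  2 * S^`().[dotp x x] <= a <=
  2 * S^`().[dotp x x] + 4 * S^`()^`().[dotp x x] * dotp x x.
Proof.
move=> S2 /eigenvalueP[v vH v0].
have := quadratic_form_radial_hessian S x v; rewrite vH.
have -> : dotp (a *: v) v = a * dotp v v.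
  by rewrite /dotp mulr_sumr; apply: eq_bigr => i _; rewrite mxE mulrA.
have vv := dotp_gt0 v0; move=> E; apply/andP; split.
  by rewrite -(ler_pM2r vv) E lerDl mulr_ge0 ?sqr_ge0// mulr_ge0.
rewrite -(ler_pM2r vv) E [leRHS]mulrDl lerD2l -[leRHS]mulrA.
rewrite ler_wpM2l ?mulr_ge0//.
by rewrite [leRHS]mulrC sqr_dotp_le.
Qed.

Section nonnegative_coefficients.
Variables (S : {poly R}) (n : nat).
Hypotheses (S0 : forall i, 0 <= S`_i) (Sn : (size S <= n)%N).

(* The normalization of the phase: dividing by it, at [r = lam ^+ 2], makes the
   phase rescaled from the annulus of size [lam] elliptic uniformly in [S]. *)
Definition nonconst_mass (r : R) : R := \sum_(j < size S | (0 < j)%N) S`_j * r ^+ j.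

Lemma nonconst_mass_ge0 r : 0 <= r -> 0 <= nonconst_mass r.
Proof. by move=> r0; apply: sumr_ge0 => j _; rewrite mulr_ge0// exprn_ge0. Qed.

Lemma deriv_horner_ge0 (r : R) : 0 <= r -> 0 <= S^`().[r].
Proof.
move=> r0; rewrite deriv_horner_sum; apply: sumr_ge0 => j _.
by rewrite mulr_ge0// mulr_ge0// exprn_ge0.
Qed.

Lemma deriv2_horner_ge0 (r : R) : 0 <= r -> 0 <= S^`()^`().[r].
Proof.
move=> r0; rewrite deriv2_horner_sum; apply: sumr_ge0 => j _.
by rewrite mulr_ge0// mulr_ge0// mulr_ge0// exprn_ge0.
Qed.

(** Term by term, j r^(j-1) >= r^n because j >= 1, j - 1 <= n and r <= 1. With r >= 1/16 on the
    reference annulus this is the lower eigenvalue bound. *)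
Lemma deriv_horner_ge (r : R) : 0 <= r <= 1 ->
  r ^+ n * nonconst_mass 1 <= S^`().[r].
Proof.
move=> /andP[r0 r1]; rewrite deriv_horner_sum /nonconst_mass mulr_sumr big_mkcond.
apply: ler_sum => j _; case: ifPn => j0; last by rewrite mulr_ge0// mulr_ge0// exprn_ge0.
rewrite expr1n mulr1 mulrC ler_wpM2l//.
rewrite (@le_trans _ _ (r ^+ j.-1))//.
  apply: ler_wiXn2l => //; apply: leq_trans Sn.
  by rewrite (leq_trans (leq_pred _))// ltnW.
by rewrite ler_peMl ?exprn_ge0// ler1n.
Qed.

(** The extra factor [r] restores the power r^j in every term, which is then monotone up to [t]; the
    coefficient in degree j is 2j + 4j(j-1) <= 4j^2 <= 4n^2. *)
Lemma hessian_weight_le (r t : R) : 0 <= r <= t ->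
  r * (2 * S^`().[r] + 4 * S^`()^`().[r] * r) <= 4 * n%:R ^+ 2 * nonconst_mass t.
Proof.
move=> /andP[r0 rt]; rewrite deriv_horner_sum deriv2_horner_sum /nonconst_mass.
rewrite [in leRHS]big_mkcond !mulr_sumr !mulr_suml -big_split /= !mulr_sumr.
apply: ler_sum => j _.
have jn : (j%:R : R) <= n%:R by rewrite ler_nat (leq_trans _ Sn)// ltnW.
(* Degrees 0 and 1 are treated apart because the truncated [j.-1] and [j.-2] misstate the exponents
   there. *)
case: (nat_of_ord j) jn => [|[|k]] jn /=.
- by rewrite !(mul0r, mulr0, addr0).
- rewrite expr0 expr1 !mul1r !(mul0r, mulr0) addr0.
  have -> : r * (2 * (S`_1 * 1)) = 2 * (S`_1 * r) by ring.
  rewrite ler_pM ?mulr_ge0 ?ler_wpM2l//.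
  have : 1 <= n%:R ^+ 2 :> R by rewrite exprn_ege1.
  lra.
- have -> : r * (2 * (S`_k.+2 * (k.+2%:R * r ^+ k.+1)) +
    4 * (S`_k.+2 * (k.+2%:R * (k.+1%:R * r ^+ k))) * r) =
    (2 * k.+2%:R * (1 + 2 * k.+1%:R)) * (S`_k.+2 * r ^+ k.+2).
    by rewrite !exprS; ring.
  apply: ler_pM.
  + by apply: mulr_ge0; [exact: mulr_ge0|apply: addr_ge0 => //; exact: mulr_ge0].
  + by apply: mulr_ge0; [exact: S0|exact: exprn_ge0].
  + have : k.+2%:R ^+ 2 <= n%:R ^+ 2 :> R by rewrite ler_sqr ?nnegrE.
    have -> : k.+2%:R = k.+1%:R + 1 :> R by rewrite natr1.
    by have := ler0n R k.+1; nra.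
  + by rewrite ler_wpM2l// lerXn2r// nnegrE// (le_trans r0).
Qed.

End nonnegative_coefficients.

End radial_hessian.

(** * Uniform ellipticity of normalized radial phases *)

Section radial_phases.
Context {R : realType} {d : nat}.
Implicit Types (x : 'rV[R]_d) (S P : {poly R}).

(** Write P(s) = E(s^2) + s O(s^2); evaluating the evenness hypothesis at |x| cancels the odd
    term. *)
Lemma radial_phaseE P : P \Po - 'X = P ->
  radial_phase P = (fun x : 'rV[R]_d => (even_poly P).[dotp x x]).
Proof.
move=> evenP; apply/funext => x; rewrite /radial_phase -sqr_enorm.
set r := enorm x.
have PE s : P.[s] = (even_poly P).[s ^+ 2] + (odd_poly P).[s ^+ 2] * s.
  by rewrite -{1}(poly_even_odd P) hornerD hornerMX !horner_comp hornerXn.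
have : P.[- r] = P.[r] by rewrite -{2}evenP horner_comp hornerN hornerX.
by rewrite !PE sqrrN; lra.
Qed.

Lemma size_even_poly_le P : (size (even_poly P) <= size P)%N.
Proof.
rewrite (leq_trans (size_even_poly P))// uphalf_half -{3}(odd_double_half (size P)).
by rewrite leq_add2l -addnn leq_addr.
Qed.

(** Half-open with ratio 2, so that its dilates by powers of 2 are disjoint and leave no gap; the
    outer radius keeps it inside the unit ball, as the elliptic estimate requires. *)
Definition reference_annulus : set 'rV[R]_d := [set x | 4^-1 <= enorm x < 2^-1].

Lemma sub_reference_annulus : reference_annulus `<=` unit_ball.
Proof. by move=> x /andP[_ x2]; rewrite /unit_ball /=; lra. Qed.

(** By the Leibniz formula the bound is m! h^m. Enlarging m! to its m-th power lets the d-th root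
    taken later come out cleanly. *)
Lemma normr_det_le m (A : 'M[R]_m) (h : R) : (0 < m)%N ->
  (forall i j, `|A i j| <= h) -> `|\det A| <= (m`!%:R * h) ^+ m.
Proof.
move=> m0 Ah; have h0 : 0 <= h.
  exact: le_trans (normr_ge0 _) (Ah (Ordinal m0) (Ordinal m0)).
rewrite (le_trans (ler_norm_sum _ _ _))//.
rewrite (@le_trans _ _ (\sum_(s : 'S_m) h ^+ m))//.
  apply: ler_sum => s _; rewrite normrM normrX normrN1 expr1n mul1r.
  rewrite normr_prod -[X in _ <= h ^+ X]card_ord -prodr_const.
  by apply: ler_prod => i _; rewrite normr_ge0 Ah.
rewrite sumr_const card_Sn -[leLHS]mulr_natl exprMn ler_wpM2r ?exprn_ge0//.
by rewrite ler_eXnr// ler1n fact_gt0.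
Qed.

Lemma hessian_weight_ge0 S (r : R) : (forall k, 0 <= S`_k) -> 0 <= r ->
  0 <= 2 * S^`().[r] + 4 * S^`()^`().[r] * r.
Proof.
move=> S0 r0; have := deriv_horner_ge0 S0 r0; have := deriv2_horner_ge0 S0 r0.
by move=> s2 s1; rewrite addr_ge0// mulr_ge0// mulr_ge0.
Qed.

Lemma normr_hessian_le S x i j : (forall k, 0 <= S`_k) ->
  `|hessian (fun y => S.[dotp y y]) x i j| <=
  2 * S^`().[dotp x x] + 4 * S^`()^`().[dotp x x] * dotp x x.
Proof.
move=> S0; rewrite hessian_radial (le_trans (ler_normD _ _))// lerD//.
  rewrite normrM ger0_norm ?mulr_ge0 ?deriv_horner_ge0 ?dotp_ge0//.
  rewrite ler_piMr ?mulr_ge0 ?deriv_horner_ge0 ?dotp_ge0//.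
  by case: eqP; rewrite ?normr1 ?normr0.
rewrite normrM ger0_norm ?mulr_ge0 ?deriv2_horner_ge0 ?dotp_ge0//.
rewrite ler_wpM2l ?mulr_ge0 ?deriv2_horner_ge0 ?dotp_ge0//.
by rewrite normrM -sqr_enorm expr2 ler_pM// coord_le_enorm.
Qed.

Lemma det_hessian_le S n (lam : R) x : (0 < d)%N -> (forall k, 0 <= S`_k) ->
  (size S <= n)%N -> 0 < lam -> reference_annulus (lam^-1 *: x) ->
  `|\det (hessian (fun y => S.[dotp y y]) x)| <=
  (d`!%:R * (64 * n%:R ^+ 2 * (nonconst_mass S (lam ^+ 2) / lam ^+ 2))) ^+ d.
Proof.
move=> d0 S0 Sn lam0; rewrite /reference_annulus /= enormZ ?invr_ge0 ?(ltW lam0)// => /andP[x1 x2].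
apply: normr_det_le => // i j; rewrite (le_trans (normr_hessian_le _ _ _ _))//.
set h := (X in X <= _).
have lx : lam * 4^-1 <= enorm x by rewrite -ler_pdivlMl.
have xl : enorm x <= lam.
  by move: x2; rewrite ltr_pdivrMl//; lra.
have rl : 0 <= dotp x x <= lam ^+ 2.
  by rewrite dotp_ge0 -sqr_enorm ler_sqr ?nnegrE ?enorm_ge0// ltW.
have h0 : 0 <= h.
  by rewrite /h hessian_weight_ge0// dotp_ge0.
have := hessian_weight_le S0 Sn rl; rewrite -/h => hM.
(* Dividing the weighted bound by |x|^2 >= lam^2 / 16 turns its constant 4 n^2 into 64 n^2. *)
have lr : lam ^+ 2 / 16 <= dotp x x.
  rewrite -sqr_enorm (_ : _ / 16 = (lam * 4^-1) ^+ 2); last by field.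
  by rewrite ler_sqr ?nnegrE ?enorm_ge0// mulr_ge0// ltW.
rewrite mulrA ler_pdivlMr ?exprn_gt0//.
have : lam ^+ 2 / 16 * h <= dotp x x * h by rewrite ler_wpM2r.
lra.
Qed.

Lemma partials_dotp_bounded N n : exists2 A : R, 0 <= A &
  forall (s : seq 'I_d) (j : nat) x, (size s <= N)%N -> (j < n)%N ->
    unit_ball x -> `|partials s (fun y => dotp y y ^+ j) x| <= A.
Proof.
have /choice[C HC] : forall sj : seq 'I_d * nat, exists c : R, 0 < c /\
    forall x, unit_ball x -> `|partials sj.1 (fun y => dotp y y ^+ sj.2) x| <= c.
  move=> [s j] /=.
  have : polyfun (partials s (fun y : 'rV[R]_d => dotp y y ^+ j)).
    apply: polyfun_partials.
    rewrite (_ : (fun y => _) = (fun y => ('X^j : {poly R}).[dotp y y])).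
      exact/polyfun_horner/polyfun_dotp.
    by apply/funext => y; rewrite hornerXn.
  move=> /(polyfun_bounded 1)[c c0 cP]; exists c; split=> // x x1.
  by apply: cP => i; rewrite (le_trans (coord_le_enorm _ _))// ltW.
(* There are finitely many derivative words of length at most [N] and exponents below [n], so the
   sum of the individual bounds dominates each one. *)
exists (\sum_(k < N.+1) \sum_(t : k.-tuple 'I_d) \sum_(j < n) C (tval t, nat_of_ord j)).
  by apply: sumr_ge0 => k _; apply: sumr_ge0 => t _; apply: sumr_ge0 => j _;
    rewrite ltW//; case: (HC (tval t, nat_of_ord j)).
move=> s j x sN jn xB; have [C0 Cs] := HC (s, j).
rewrite (le_trans (Cs _ xB))//.
have sN' : (size s < N.+1)%N by [].
have Cge0 sj : 0 <= C sj by rewrite ltW//; case: (HC sj).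
rewrite (bigD1 (Ordinal sN'))//= (bigD1 (in_tuple s))//= (bigD1 (Ordinal jn))//=.
rewrite -!addrA lerDl !addr_ge0//; do ?[apply: sumr_ge0 => ? _] => //.
Qed.

(** The normalization makes the nonconstant coefficients weights of total mass 1, so derivative
    bounds for the powers of |x|^2 pass to [S] without loss. The constant term may be arbitrarily
    large, but the gradient norm only involves derivatives of order at least 1. *)
Lemma annulus_elliptic N n : exists A eps : R, 0 < eps < 1 /\
  forall S, (forall k, 0 <= S`_k) -> (size S <= n)%N -> nonconst_mass S 1 = 1 ->
    elliptic_phase A N eps reference_annulus (fun x => S.[dotp x x]).
Proof.
have [A A0 HA] := partials_dotp_bounded N.+1 n.
(* The eigenvalues lie between 2 * 16^-n and 64 n^2; [K] is chosen to enclose both strictly and to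
   exceed 1 even when n = 0. *)
pose K : R := 65 * 16 ^+ n * (n%:R + 1) ^+ 2.
have n1 : 1 <= (n%:R + 1) ^+ 2 :> R by rewrite exprn_ege1// lerDr.
have p16 : 1 <= 16 ^+ n :> R by rewrite exprn_ege1// ler1n.
have K65 : 65 * (n%:R + 1) ^+ 2 <= K.
  by rewrite /K mulrAC ler_peMr// mulr_ge0.
exists A, K^-1; split.
  by rewrite invr_gt0 invf_lt1//; lra.
move=> S S0 Sn S1; split.
- exact/polyfun_Ck/polyfun_horner/polyfun_dotp.
- apply: ub_ereal_sup => _ [s /andP[s1 sN] [x xB <-]]; rewrite lee_fin.
  have -> : (fun x : 'rV[R]_d => S.[dotp x x]) =
      (fun x => \sum_(j < size S) S`_j * dotp x x ^+ j).
    by apply/funext => y; rewrite horner_coef.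
  rewrite partials_lincomb; last first.
    move=> j; rewrite (_ : (fun y => _) = (fun y => ('X^j : {poly R}).[dotp y y])).
      exact/polyfun_horner/polyfun_dotp.
    by apply/funext => y; rewrite hornerXn.
  rewrite (le_trans (ler_norm_sum _ _ _))//.
  rewrite (@le_trans _ _ (\sum_(j < size S | (0 < j)%N) S`_j * A))//; last first.
    rewrite -mulr_suml -[leRHS]mul1r ler_wpM2r// -S1.
    by apply: ler_sum => j _; rewrite expr1n mulr1.
  rewrite [leRHS]big_mkcond; apply: ler_sum => j _; rewrite normrM.
  case: ifPn => [j0|]; first rewrite ger0_norm// ler_wpM2l// HA//.
    by rewrite (leq_trans (ltn_ord j)).
  rewrite -eqn0Ngt => /eqP ->.
  rewrite (_ : (fun y => _) = fun=> 1); last by apply/funext => y; rewrite expr0.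
  by rewrite partials_cst -?size_eq0 -?lt0n// normr0 mulr0.
- move=> x /andP[x1 x2] a.
  have xx : 0 <= dotp x x <= 1.
    by rewrite dotp_ge0 -sqr_enorm expr_le1// ?enorm_ge0//; lra.
  have r16 : 16^-1 <= dotp x x.
    by rewrite -sqr_enorm (_ : 16^-1 = 4^-1 ^+ 2); [rewrite ler_sqr ?nnegrE ?enorm_ge0|field].
  move=> /(radial_eigenvalue (deriv2_horner_ge0 S0 (dotp_ge0 x)))/andP[a1 a2].
  have := deriv_horner_ge S0 Sn xx; rewrite S1 mulr1 => low.
  have /(hessian_weight_le S0 Sn) : 0 <= dotp x x <= 1 by [].
  rewrite S1 mulr1; set h := (X in _ * X) => up.
  have low' : 16^-1 ^+ n <= S^`().[dotp x x].
    by rewrite (le_trans _ low)// lerXn2r// nnegrE// dotp_ge0.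
  have K16 : K^-1 <= 16^-1 ^+ n.
    rewrite exprVn lef_pV2 ?posrE ?exprn_gt0//; last lra.
    by rewrite /K; nra.
  have p0 : 0 < 16^-1 ^+ n :> R by rewrite exprn_gt0.
  apply/andP; split; first lra.
  rewrite invrK (le_lt_trans a2)// -/h.
  have h64 : h <= 64 * n%:R ^+ 2.
    have : 16^-1 * h <= dotp x x * h.
      by rewrite ler_wpM2r// /h hessian_weight_ge0// dotp_ge0.
    lra.
  have := ler0n R n; nra.
Qed.

End radial_phases.

(** * Lebesgue norms and scaling *)

Section measure_scaling.
Context d {T : measurableType d} {R : realType}.
Variables (mu : {measure set T -> \bar R}) (phi : T -> T) (c : R).

(** Equivalently, the pushforward of [mu] is [c] times [mu]; multiplication by [a] on the line
    therefore has the constant a^-1. *)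
Definition scales_measure := [/\ measurable_fun setT phi, 0 < c &
  forall A, measurable A -> mu (phi @^-1` A) = (c%:E * mu A)%E].

Hypothesis phi_c : scales_measure.

Lemma ge0_integral_scale (f : T -> \bar R) : measurable_fun setT f ->
  (forall x, 0 <= f x)%E ->
  (\int[mu]_x f (phi x) = c%:E * \int[mu]_x f x)%E.
Proof.
move=> mf f0; have [mphi c0 E] := phi_c.
transitivity (\int[pushforward mu phi]_x f x)%E.
  by rewrite (ge0_integral_pushforward mphi).
rewrite [LHS](eq_measure_integral (mscale (NngNum (ltW c0)) mu)) ; last first.
  by move=> A mA _; rewrite /= /mscale /pushforward E.
by rewrite ge0_integral_mscale.
Qed.

Lemma integral_scale (f : T -> \bar R) : measurable_fun setT f ->
  (\int[mu]_x f (phi x) = c%:E * \int[mu]_x f x)%E.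
Proof.
move=> mf; have [_ c0 _] := phi_c.
rewrite integralE [in RHS]integralE.
have -> : (\int[mu]_x (fun x => f (phi x))^\+ x)%E = (c%:E * \int[mu]_x f^\+ x)%E.
  rewrite -(ge0_integral_scale (measurable_funepos mf)); last by move=> x; exact: funepos_ge0.
  by apply: eq_integral => x _; rewrite !funeposE.
have -> : (\int[mu]_x (fun x => f (phi x))^\- x)%E = (c%:E * \int[mu]_x f^\- x)%E.
  rewrite -(ge0_integral_scale (measurable_funeneg mf)); last by move=> x; exact: funeneg_ge0.
  by apply: eq_integral => x _; rewrite !funenegE.
have cy : (c%:E * +oo = +oo)%E by rewrite gt0_muley// lte_fin.
have cNy : (c%:E * -oo = -oo)%E by rewrite gt0_muleNy// lte_fin.
(* Without integrability the infinite cases remain, including the conventional value of oo - oo;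
   multiplication by c > 0 respects all of them. *)
case: (\int[mu]_x f^\+ x)%E => [a| |]; case: (\int[mu]_x f^\- x)%E => [b| |];
  rewrite /= ?(cy, cNy)//= ?(cy, cNy)//=.
by transitivity (c * (a - b))%:E; rewrite // mulrBr.
Qed.

Lemma ae_scale (P : T -> Prop) :
  (\forall x \ae mu, P x) -> \forall x \ae mu, P (phi x).
Proof.
move=> [A [mA A0 PA]]; have [mphi c0 E] := phi_c.
exists (phi @^-1` A); split.
- by rewrite -[X in measurable X]setTI; exact: mphi.
- by rewrite [LHS](E _ mA) A0 mule0.
- by move=> x /= /PA.
Qed.

End measure_scaling.

Lemma ge0_lee_poweR (R : realType) (r : R) (x y : \bar R) : 0 <= r ->
  (0 <= x)%E -> (x <= y)%E -> (x `^ r <= y `^ r)%E.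
Proof.
move=> r0 x0 xy; apply: (gt0_ler_poweR r0) => //; rewrite in_itv /= leey andbT //.
exact: le_trans xy.
Qed.

Section Lnorm_comparison.
Context d {T : measurableType d} {R : realType}.
Variable mu : {measure set T -> \bar R}.
Implicit Types f g : T -> R[i].

Lemma cmeasurable_normc f : cmeasurable_fun setT f ->
  measurable_fun setT (fun x => Normc.normc (f x)).
Proof.
move=> [mre mim].
rewrite (_ : (fun x => _) = (fun x => Num.sqrt (complex.Re (f x) ^+ 2 + complex.Im (f x) ^+ 2))).
  apply: (@measurableT_comp _ _ _ _ _ _ (@Num.sqrt R)).
    by apply: continuous_measurable_fun; exact: sqrt_continuous.
  by apply: measurable_funD; exact: measurable_funX.
by apply/funext => x; case: (f x).
Qed.

Lemma normc_ge0 (z : R[i]) : 0 <= Normc.normc z.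
Proof. by case: z => a b; exact: sqrtr_ge0. Qed.

(** A single comparison covers the space-time dilation, the frequency dilation, and, with the
    identity map, plain pointwise domination. *)
Lemma cLnorm_le_scale (p : \bar R) (phi : T -> T) (c k : R) f g :
  (1 <= p)%E -> scales_measure mu phi c -> 0 <= k ->
  cmeasurable_fun setT f -> cmeasurable_fun setT g ->
  (forall x, Normc.normc (f x) <= k * Normc.normc (g (phi x))) ->
  (cLnorm mu p f <= (k * c `^ fine p^-1)%:E * cLnorm mu p g)%E.
Proof.
move=> p1 sc k0 mf mg fg; have [mphi c0 _] := sc.
have mfn := cmeasurable_normc mf; have mgn := cmeasurable_normc mg.
case: p p1 => [p p1| _|//]; last first.
  (* At [p = +oo] the exponent [fine p^-1] is 0 and the factor of [c] disappears: essential suprema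
     only need null sets to pull back to null sets. *)
  rewrite /cLnorm invey /= powRr0 mulr1 unlock.
  case: ifPn => muT; last by rewrite mule0.
  apply/ess_supP.
  have /(ae_scale sc) := ess_sup_ge mu (abse \o (fun x => (Normc.normc (g x))%:E)).
  apply: filterS => x /= gx; rewrite ger0_norm ?normc_ge0//.
  rewrite (@le_trans _ _ (k%:E * `|Normc.normc (g (phi x))|%:E)%E)//; last first.
    by rewrite lee_wpmul2l.
  by rewrite ger0_norm ?normc_ge0// -EFinM lee_fin.
have p0 : 0 < p by rewrite (lt_le_trans ltr01).
rewrite /cLnorm unlock inver gt_eqF//=.
rewrite (_ : k * _ = (k `^ p * c) `^ p^-1); last first.
  by rewrite powRM ?powR_ge0// ?(ltW c0)// -powRrM mulfV ?gt_eqF// powRr1.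
have I0 (h : T -> R) : (0 <= \int[mu]_x `|(h x)%:E| `^ p)%E.
  by apply: integral_ge0 => x _; exact: poweR_ge0.
have mpow (h : T -> R) : measurable_fun setT h ->
    measurable_fun setT (fun x => `|(h x)%:E| `^ p)%E.
  move=> /measurable_EFinP mh.
  apply: (measurableT_comp (measurable_poweR p)).
  by apply: measurableT_comp => //.
have kc0 : 0 <= k `^ p * c by rewrite mulr_ge0 ?powR_ge0// ltW.
rewrite -poweR_EFin -poweRM ?I0//.
apply: ge0_lee_poweR; rewrite ?invr_ge0 ?(ltW p0) ?I0//.
rewrite EFinM -muleA -(ge0_integral_scale sc (mpow _ mgn)); last first.
  by move=> x; exact: poweR_ge0.
rewrite -ge0_integralZl//=; last 2 first.
- exact: (measurableT_comp (mpow _ mgn) mphi).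
- by rewrite lee_fin powR_ge0.
apply: ge0_le_integral => //=.
- exact: mpow.
- by apply: emeasurable_funM => //; exact: (measurableT_comp (mpow _ mgn) mphi).
move=> x _; rewrite !ger0_norm ?normc_ge0// -EFinM lee_fin -powRM// ?normc_ge0//.
by apply: ge0_ler_powR; rewrite ?nnegrE ?mulr_ge0 ?normc_ge0// ltW.
Qed.

Lemma scales_measure_id : scales_measure mu id 1.
Proof. by split=> // A _; rewrite mul1e. Qed.

Lemma cLnorm_le (p : \bar R) (k : R) f g : (1 <= p)%E -> 0 <= k ->
  cmeasurable_fun setT f -> cmeasurable_fun setT g ->
  (forall x, Normc.normc (f x) <= k * Normc.normc (g x)) ->
  (cLnorm mu p f <= k%:E * cLnorm mu p g)%E.
Proof.
move=> p1 k0 mf mg fg.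
have := cLnorm_le_scale p1 scales_measure_id k0 mf mg fg.
by rewrite powR1 mulr1.
Qed.

End Lnorm_comparison.

(** * Dilations of Lebesgue measure *)

Section lebesgue_scaling.
Context {R : realType}.

Lemma scales_measure_prod d1 d2 (T1 : measurableType d1) (T2 : measurableType d2)
    (m1 : {sigma_finite_measure set T1 -> \bar R})
    (m2 : {sigma_finite_measure set T2 -> \bar R})
    (phi1 : T1 -> T1) (phi2 : T2 -> T2) (c1 c2 : R) :
  scales_measure m1 phi1 c1 -> scales_measure m2 phi2 c2 ->
  scales_measure (m1 \x m2)%E (fun z => (phi1 z.1, phi2 z.2)) (c1 * c2).
Proof.
move=> [mphi1 c10 E1] [mphi2 c20 E2].
have c0 : 0 < c1 * c2 by exact: mulr_gt0.
have mphi : measurable_fun setT (fun z : T1 * T2 => (phi1 z.1, phi2 z.2)).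
  apply/measurable_fun_pairP; split.
  - exact: (measurableT_comp mphi1 measurable_fst).
  - exact: (measurableT_comp mphi2 measurable_snd).
split=> // A mA.
have ci0 : 0 <= (c1 * c2)^-1 by rewrite invr_ge0 ltW.
pose pm := measure_function_pushforward__canonical__measure_function_Measure
  (m1 \x m2)%E mphi.
pose m' := mscale (NngNum ci0) pm.
(* The pushforward divided by [c1 * c2] agrees with the product measure on rectangles, hence
   everywhere by uniqueness. *)
have E : ((m1 \x m2) A)%E = m' A.
  apply: product_measure_unique => // B C mB mC.
  transitivity ((c1 * c2)^-1%:E *
    (m1 \x m2) ((phi1 @^-1` B) `*` (phi2 @^-1` C)))%E; first by [].
  rewrite product_measure1E; last 2 first.
  - by rewrite -[X in measurable X]setTI; exact: mphi1.
  - by rewrite -[X in measurable X]setTI; exact: mphi2.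
  by rewrite E1// E2// muleACA -EFinM [LHS]muleA -EFinM mulVf ?mul1e// gt_eqF.
transitivity ((c1 * c2)%:E * m' A)%E; last by congr (_ * _)%E; exact/esym/E.
by rewrite /m' /mscale /pm /pushforward /= muleA -EFinM divff ?mul1e// gt_eqF.
Qed.

Lemma scales_lebesgue_measure (a : R) : 0 < a ->
  scales_measure lebesgue_measure (fun t : measurableTypeR R => a * t : measurableTypeR R) a^-1.
Proof.
move=> a0; have ma : measurable_fun setT (fun t : measurableTypeR R => a * t : measurableTypeR R).
  by apply: measurable_funM; [exact: measurable_cst|exact: measurable_id].
split; [by []|by rewrite invr_gt0|move=> A mA].
pose pm := measure_function_pushforward__canonical__measure_function_Measure
  (@lebesgue_measure R) ma.
have E : lebesgue_measure A = mscale (NngNum (ltW a0)) pm A.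
  apply: lebesgue_measure_unique => // _ [[x y]] _ <-.
  transitivity (a%:E * lebesgue_measure
    ((fun t : measurableTypeR R => (a * t)%R : measurableTypeR R) @^-1` `]x, y]%classic))%E; last by [].
  rewrite (_ : _ @^-1` _ = `]a^-1 * x, a^-1 * y]%classic); last first.
    by apply/seteqP; split=> t /=; rewrite !in_itv /= ltr_pdivrMl// ler_pdivlMl.
  rewrite !lebesgue_measure_itv /= !lte_fin ltr_pM2l ?invr_gt0//.
  case: ifPn => _; last by rewrite mule0.
  by rewrite -!EFinB -EFinM -mulrBr mulrA divff ?mul1r// gt_eqF.
transitivity (a^-1%:E * mscale (NngNum (ltW a0)) pm A)%E.
  by rewrite /mscale /pm /pushforward /= muleA -EFinM mulVf ?mul1e// gt_eqF.
by congr (_ * _)%E; exact/esym/E.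
Qed.

Lemma measurable_scaler d (a : R) : measurable_fun setT (fun x : 'rV[R]_d => a *: x).
Proof.
apply: measurable_fun_rVP => i.
rewrite (_ : (fun x => _) = (fun x : 'rV[R]_d => a * x ord0 i)).
  by apply: measurable_funM; [exact: measurable_cst|exact: measurable_coord].
by apply/funext => x; rewrite mxE.
Qed.

Lemma scales_lebesgue_rV d (a : R) : 0 < a ->
  scales_measure (lebesgue_rV d) (fun x => a *: x) (a^-1 ^+ d).
Proof.
move=> a0; elim: d => [|d IH].
  split=> [|//|A mA]; first exact: measurable_scaler.
  rewrite expr0 mul1e (_ : _ @^-1` A = A)//.
  by apply/seteqP; split=> x; rewrite /= (_ : a *: x = x)//; apply/rowP => -[].
split=> [||A mA]; [exact: measurable_scaler|by rewrite exprn_gt0// invr_gt0|].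
have [_ _ E] := scales_measure_prod (scales_lebesgue_measure a0) IH.
rewrite exprS -E /=.
  rewrite /lebesgue_rV_step /pushforward; congr (product_measure1 _ _ _).
  apply/seteqP; split=> -[t x] /=; rewrite (_ : rV_cons (a * t, _) = a *: rV_cons (t, x))//;
    by apply/rowP => i; rewrite !mxE /=; case: unliftP => [j|] _ //=; rewrite mxE.
by rewrite -[X in measurable X]setTI; exact: measurable_rV_cons.
Qed.

(** Dimension 0 is excluded because there the measure is the Dirac mass at this very point. *)
Lemma lebesgue_rV_set0 d : (0 < d)%N -> lebesgue_rV d [set (0 : 'rV[R]_d)] = 0%E.
Proof.
move=> d0; rewrite (_ : [set _] = [set x : 'rV[R]_d | forall i, [set (0 : R)] (x ord0 i)]).
  apply: etrans (@lebesgue_rV_box R d (fun=> [set (0 : R)]) (fun=> measurable_set1 _)) _.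
  by rewrite (bigD1 (Ordinal d0))//= lebesgue_measure_set1 mul0e.
apply/seteqP; split=> x /=; first by move=> -> i; rewrite mxE.
by move=> x0; apply/rowP => i; rewrite mxE x0.
Qed.

Lemma measurable_rV_set0 d : measurable [set (0 : 'rV[R]_d)].
Proof.
rewrite (_ : [set _] = \bigcap_(i in [set: 'I_d]) ((fun x : 'rV[R]_d => x ord0 i) @^-1` [set 0])).
  apply: fin_bigcap_measurable => [|i _]; first exact: finite_finset.
  rewrite -[X in measurable X]setTI.
  by apply: measurable_coord => //; exact: measurable_set1.
apply/seteqP; split=> x /=; first by move=> -> i _ /=; rewrite mxE.
by move=> x0; apply/rowP => i; rewrite mxE; exact: x0.
Qed.

Lemma lebesgue_rV_enorm_lt d (r : R) : (lebesgue_rV d [set x | (enorm x < r)%R] < +oo)%E.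
Proof.
pose B := [set x : 'rV[R]_d | forall i, `[- r, r]%classic (x ord0 i)].
apply: (@le_lt_trans _ _ (lebesgue_rV d B)).
  apply: le_measure; rewrite ?inE.
  - rewrite (_ : mkset _ = (@enorm R d) @^-1` `]-oo, r[).
      by rewrite -[X in measurable X]setTI; apply: measurable_enorm.
    by apply/seteqP; split=> x /=; rewrite in_itv.
  - rewrite (_ : B = \bigcap_(i in [set: 'I_d]) ((fun x : 'rV[R]_d => x ord0 i) @^-1` `[- r, r]%classic)).
      apply: fin_bigcap_measurable => [|i _]; first exact: finite_finset.
  rewrite -[X in measurable X]setTI.
      by apply: measurable_coord => //; exact: measurable_itv.
    by apply/seteqP; split=> x /= xB i; [move=> _|]; exact: xB.
  - move=> x /= xr i /=; rewrite in_itv /= -ler_norml.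
    exact: le_trans (coord_le_enorm x i) (ltW xr).
have := @lebesgue_rV_box R d (fun=> `[- r, r]%classic) (fun=> measurable_itv _).
rewrite -/B => ->; rewrite lebesgue_measure_itv.
suff [c ->] : exists c : R, (\prod_(i < d) (if (((- r)%:E < r%:E)) then r%:E - (- r)%:E else 0) = c%:E)%E.
  exact: ltry.
apply: (big_ind (fun y : \bar R => exists c : R, y = c%:E)); first by exists 1.
  by move=> _ _ [a ->] [b ->]; exists (a * b).
by move=> i _; case: ifP => _; [exists (r - - r)|exists 0].
Qed.

End lebesgue_scaling.

(** * Hoelder and Minkowski inequalities *)

Section Lnorm_inequalities.
Context d {T : measurableType d} {R : realType}.
Variable mu : {measure set T -> \bar R}.

Lemma integral_normc_le_cLnorm (p : \bar R) (U : set T) :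
  (1 < p)%E -> measurable U -> (mu U < +oo)%E ->
  exists2 C : R, 0 <= C & forall f : T -> R[i], cmeasurable_fun setT f ->
    (\int[mu]_(x in U) (Normc.normc (f x))%:E <= C%:E * cLnorm mu p f)%E.
Proof.
move=> p1 mU Uoo.
have Ufin : mu U \is a fin_num by rewrite ge0_fin_numE.
have n0 (f : T -> R[i]) x : (0 <= (Normc.normc (f x))%:E)%E by rewrite lee_fin normc_ge0.
case: p p1 => [p| |] // p1; last first.
  exists (fine (mu U)); first by rewrite fine_ge0.
  move=> f mf; have /measurable_EFinP mn := cmeasurable_normc mf.
  (* The norm at [+oo] is an essential supremum only when the total mass is positive, which a
     non-null [U] guarantees. *)
  have [U0|U0] := eqVneq (mu U) 0%E.
    rewrite null_set_integral//; last exact: measurable_funS mn.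
    by rewrite mule_ge0 ?lee_fin ?fine_ge0// Lnorm_ge0.
  rewrite fineK// /cLnorm unlock ifT; last first.
    apply: (@lt_le_trans _ _ (mu U)); first by rewrite lt0e U0 measure_ge0.
    by apply: le_measure; rewrite ?inE.
  set y := ess_sup mu _.
  rewrite muleC -integral_cst//.
  have ay : \forall x \ae mu, (`|(Normc.normc (f x))%:E| <= y)%E.
    exact: (ess_sup_ge mu (abse \o (fun x => (Normc.normc (f x))%:E))).
  have y0 : (0 <= y)%E.
    rewrite ess_sup_gee//; last by apply/nearW => x /=; rewrite lee_fin.
    apply: (@lt_le_trans _ _ (mu U)); first by rewrite lt0e U0 measure_ge0.
    by apply: le_measure; rewrite ?inE.
  apply: ae_ge0_le_integral => //.
  - exact: measurable_funS mn.
  - by apply: filterS ay => x; rewrite gee0_abs// => xy _.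
have p0 : 0 < p by rewrite (lt_trans ltr01).
have q0 : 0 < p / (p - 1) by rewrite divr_gt0// subr_gt0.
have pq : p^-1 + (p / (p - 1))^-1 = 1.
  by field; rewrite !gt_eqF// subr_gt0.
pose C := ('N[mu]_(p / (p - 1))%:E[EFin \o (\1_U : T -> R)])%E.
have Cfin : C \is a fin_num.
  rewrite ge0_fin_numE ?Lnorm_ge0// /C unlock poweR_lty//.
  rewrite (_ : (fun x => _) = (fun x => (\1_U x)%:E)); last first.
    apply/funext => x; rewrite /= indicE; case: (x \in U) => /=.
      by rewrite normr1 powR1.
    by rewrite normr0 powR0// gt_eqF.
  by rewrite integral_indic// setIT.
exists (fine C); first by rewrite fine_ge0// Lnorm_ge0.
move=> f mf; have mn := cmeasurable_normc mf.
rewrite fineK// muleC.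
have mi : measurable_fun setT (\1_U : T -> R) by exact: measurable_indic.
apply: le_trans (hoelder mu mn mi p0 q0 pq).
rewrite Lnorm1 integral_mkcond; apply: ge0_le_integral => //.
- move=> x _; rewrite /patch; case: ifP => _ //.
- apply/measurable_restrict => //; rewrite setTI.
  by apply/measurable_EFinP; exact: measurable_funS mn.
- do 2 apply: measurableT_comp => //; apply: measurable_funM => //; exact: measurable_indic.
- move=> x _; rewrite /patch /=; case: ifPn => [xU|_]; last by rewrite lee_fin.
  by rewrite indicE xU /= mulr1 lee_fin ler_norm.
Qed.

(** Minkowski for the partial sums of the moduli, then monotone convergence of their q-th powers.
    Pointwise domination in the extended reals avoids any discussion of convergence in L^q. *)
Lemma cLnorm_series_le (q : R) (v : T -> R[i]) (w : nat -> T -> R[i]) :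
  1 <= q -> cmeasurable_fun setT v -> (forall k, cmeasurable_fun setT (w k)) ->
  (forall x, ((Normc.normc (v x))%:E <=
    \sum_(k <oo) (Normc.normc (w k x))%:E)%E) ->
  (cLnorm mu q%:E v <= \sum_(k <oo) cLnorm mu q%:E (w k))%E.
Proof.
move=> q1 mv mw vw.
have q0 : 0 < q by rewrite (lt_le_trans ltr01).
set B := (X in (_ <= X)%E).
have B0 : (0 <= B)%E by apply: nneseries_ge0 => k _ _; exact: Lnorm_ge0.
pose G n x := \sum_(0 <= k < n) Normc.normc (w k x).
have G0 n x : 0 <= G n x by apply: sumr_ge0 => k _; exact: normc_ge0.
have mG n : measurable_fun setT (G n).
  rewrite /G; elim: n => [|n IH].
    by under eq_fun do rewrite big_nil; exact: measurable_cst.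
  under eq_fun do rewrite big_nat_recr//=.
  by apply: measurable_funD => //; exact: cmeasurable_normc.
have NG n : ('N[mu]_q%:E[EFin \o G n] <= B)%E.
  apply: (@le_trans _ _ (\sum_(0 <= k < n) cLnorm mu q%:E (w k))%E); last first.
    by apply: nneseries_lim_ge => k _ _; exact: Lnorm_ge0.
  elim: n => [|n IH].
    rewrite big_nil (_ : EFin \o G 0%N = cst 0%E) ?Lnorm0// ?eqe ?gt_eqF//.
    by apply/funext => x; rewrite /G /= big_nil.
  rewrite big_nat_recr//= (_ : G n.+1 = (G n \+ (fun x => Normc.normc (w n x)))%R).
    apply: le_trans (minkowski_EFin _ _ _ _) _ => //; first exact: cmeasurable_normc.
    exact: leeD.
  by apply/funext => x; rewrite /G big_nat_recr.
pose g n x := ((G n x)%:E `^ q)%E.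
have g0 n x : (0 <= g n x)%E by exact: poweR_ge0.
have ndg x : {homo g^~ x : n m / (n <= m)%N >-> (n <= m)%E}.
  move=> n m nm; apply: ge0_lee_poweR; rewrite ?lee_fin ?(ltW q0)//.
  by rewrite /G (big_cat_nat (leq0n n) nm)/= lerDl; apply: sumr_ge0 => k _; exact: normc_ge0.
have mg n : measurable_fun setT (g n).
  apply: (measurableT_comp (measurable_poweR q)); exact/measurable_EFinP.
have cg x : cvgn (g^~ x) by exact/ereal_nondecreasing_is_cvgn/ndg.
have Ig n : (\int[mu]_x g n x <= B `^ q)%E.
  have := NG n; rewrite unlock => h.
  have := ge0_lee_poweR (ltW q0) (poweR_ge0 _ _) h.
  rewrite -poweRrM mulVf ?gt_eqF// poweRe1; last by apply: integral_ge0 => x _; exact: poweR_ge0.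
  apply: le_trans; rewrite le_eqVlt; apply/orP; left; apply/eqP.
  by apply: eq_integral => x _; rewrite /g /= ger0_norm.
have Ilim : (\int[mu]_x (limn (g^~ x)) <= B `^ q)%E.
  rewrite monotone_convergence//.
  apply: lime_le; last by near=> n; exact: Ig.
  apply: ereal_nondecreasing_is_cvgn => n m nm.
  by apply: ge0_le_integral => // x _; exact: ndg.
rewrite /cLnorm unlock.
rewrite (_ : B = (B `^ q) `^ q^-1)%E; last by rewrite -poweRrM mulfV ?gt_eqF// poweRe1.
apply: ge0_lee_poweR; rewrite ?invr_ge0 ?(ltW q0)//.
  by apply: integral_ge0 => x _; exact: poweR_ge0.
apply: le_trans Ilim; apply: ge0_le_integral => //.
- by move=> x _; exact: poweR_ge0.
- apply: (measurableT_comp (measurable_poweR q)); apply: measurableT_comp => //.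
  by apply/measurable_EFinP; exact: cmeasurable_normc.
- apply: (emeasurable_fun_cvg g) => // x _; exact: cg.
move=> x _.
have lim0 : (0 <= limn (g^~ x))%E by apply: lime_ge => //; apply: nearW => n.
rewrite (_ : limn (g^~ x) = (limn (g^~ x) `^ q^-1) `^ q)%E; last first.
  by rewrite -poweRrM mulVf ?gt_eqF// poweRe1.
apply: ge0_lee_poweR; rewrite ?(ltW q0)//.
rewrite gee0_abs ?lee_fin ?normc_ge0//.
apply: le_trans (vw x) _; apply: lime_le.
  by apply: is_cvg_nneseries => k _ _; rewrite lee_fin normc_ge0.
apply: nearW => n.
have : (g n x <= limn (g^~ x))%E.
  by apply: lime_ge => //; exists n => //= m nm; exact: ndg.
move=> /(ge0_lee_poweR (r := q^-1)); rewrite invr_ge0 (ltW q0) g0 => /(_ isT isT).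
by rewrite /g -poweRrM mulfV ?gt_eqF// poweRe1 ?lee_fin// /G sumEFin.
Unshelve. all: by end_near. Qed.

End Lnorm_inequalities.

(** * Complex-valued integrals *)

Section complex_functions.
Context {R : realType}.

Lemma normr_Re_le (z : R[i]) : `|complex.Re z| <= Normc.normc z.
Proof.
case: z => a b /=; rewrite -sqrtr_sqr ler_sqrt ?addr_ge0 ?sqr_ge0//.
by rewrite lerDl sqr_ge0.
Qed.

Lemma normr_Im_le (z : R[i]) : `|complex.Im z| <= Normc.normc z.
Proof.
case: z => a b /=; rewrite -sqrtr_sqr ler_sqrt ?addr_ge0 ?sqr_ge0//.
by rewrite lerDr sqr_ge0.
Qed.

Lemma normc_le_ReIm (z : R[i]) : Normc.normc z <= `|complex.Re z| + `|complex.Im z|.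
Proof.
case: z => a b /=; rewrite -[leRHS]ger0_norm// -sqrtr_sqr ler_sqrt ?sqr_ge0//.
by rewrite sqrrD !real_normK ?num_real// addrAC lerDl mulrn_wge0.
Qed.

Lemma normc_real (a : R) : Normc.normc a%:C = `|a|.
Proof. by rewrite /= expr0n /= addr0 sqrtr_sqr. Qed.

Lemma normc_expi (t : R) : Normc.normc (expi t) = 1.
Proof. by rewrite /= cos2Dsin2 sqrtr1. Qed.

Lemma normc_rmul d (w : 'rV[R]_d -> R) (f : 'rV[R]_d -> R[i]) x :
  Normc.normc (rmul w f x) = `|w x| * Normc.normc (f x).
Proof. by rewrite Normc.normcM normc_real. Qed.

Lemma ReM (z w : R[i]) : complex.Re (z * w) =
  complex.Re z * complex.Re w - complex.Im z * complex.Im w.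
Proof. by case: z w => [a b] [x y]. Qed.

Lemma ImM (z w : R[i]) : complex.Im (z * w) =
  complex.Re z * complex.Im w + complex.Im z * complex.Re w.
Proof. by case: z w => [a b] [x y]. Qed.

Section measurability.
Context d (T : measurableType d).

Lemma cmeasurable_mul (f g : T -> R[i]) : cmeasurable_fun setT f ->
  cmeasurable_fun setT g -> cmeasurable_fun setT (fun x => f x * g x).
Proof.
move=> [rf jf] [rg jg]; split.
  under eq_fun do rewrite ReM.
  by apply: measurable_funB; exact: measurable_funM.
under eq_fun do rewrite ImM.
by apply: measurable_funD; exact: measurable_funM.
Qed.

Lemma cmeasurable_real (w : T -> R) : measurable_fun setT w ->
  cmeasurable_fun setT (fun x => (w x)%:C).
Proof. by move=> mw; split => //=; exact: measurable_cst. Qed.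

Lemma cmeasurable_expi (t : T -> R) : measurable_fun setT t ->
  cmeasurable_fun setT (fun x => expi (t x)).
Proof.
move=> mt; split=> /=.
  apply: (@measurableT_comp _ _ _ _ _ _ (@cos R)) => //.
  by apply: continuous_measurable_fun; exact: continuous_cos.
apply: (@measurableT_comp _ _ _ _ _ _ (@sin R)) => //.
by apply: continuous_measurable_fun; exact: continuous_sin.
Qed.

Lemma cmeasurable_comp d' (T' : measurableType d') (f : T -> R[i]) (phi : T' -> T) :
  cmeasurable_fun setT f -> measurable_fun setT phi ->
  cmeasurable_fun setT (fun x => f (phi x)).
Proof.
move=> [rf jf] mphi; split.
  exact: (measurableT_comp rf mphi).
exact: (measurableT_comp jf mphi).
Qed.

(** Tonelli applies to the positive and negative parts separately, and [fine] is measurable, so no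
    integrability is involved. *)
Lemma measurable_Rintegral_param d' (Z : measurableType d')
    (mu : {sigma_finite_measure set T -> \bar R}) (F : Z * T -> R) :
  measurable_fun setT F -> measurable_fun setT (fun z => \int[mu]_x F (z, x)).
Proof.
move=> /measurable_EFinP mF; rewrite /Rintegral.
apply: (@measurableT_comp _ _ _ _ _ _ (@fine R)) => //.
under eq_fun do rewrite integralE.
apply: emeasurable_funB.
- rewrite (_ : (fun z => _) = fubini_F mu ((EFin \o F)^\+)%E).
    by apply: measurable_fun_fubini_tonelli_F => //; exact: measurable_funepos.
  by apply/funext => z; apply: eq_integral => x _; rewrite !funeposE.
- rewrite (_ : (fun z => _) = fubini_F mu ((EFin \o F)^\-)%E).
    by apply: measurable_fun_fubini_tonelli_F => //; exact: measurable_funeneg.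
  by apply/funext => z; apply: eq_integral => x _; rewrite !funenegE.
Qed.

End measurability.

Lemma cmeasurable_cintegral_param d d' (T : measurableType d) (Z : measurableType d')
    (mu : {sigma_finite_measure set T -> \bar R}) (F : Z * T -> R[i]) :
  cmeasurable_fun setT F ->
  cmeasurable_fun setT (fun z => cintegral mu setT (fun x => F (z, x))).
Proof.
move=> [rF jF]; split.
  exact: (measurable_Rintegral_param _ rF).
exact: (measurable_Rintegral_param _ jF).
Qed.

Section integrals.
Context d (T : measurableType d) (mu : {measure set T -> \bar R}).

Lemma cintegrable_normc (F : T -> R[i]) : cmeasurable_fun setT F ->
  (\int[mu]_x (Normc.normc (F x))%:E < +oo)%E -> cintegrable mu setT F.
Proof.
move=> mF Foo; have /measurable_EFinP mn := cmeasurable_normc mF.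
have I : mu.-integrable setT (fun x => (Normc.normc (F x))%:E).
  apply/integrableP; split => //.
  by under eq_integral => x _ do rewrite gee0_abs ?lee_fin ?normc_ge0//.
have [rF jF] := mF.
split; apply: le_integrable I => //.
- exact/measurable_EFinP.
- by move=> x _; rewrite /= lee_fin (ger0_norm (normc_ge0 _)) normr_Re_le.
- exact/measurable_EFinP.
- by move=> x _; rewrite /= lee_fin (ger0_norm (normc_ge0 _)) normr_Im_le.
Qed.

(** The factor 2 is the price of estimating the real and imaginary parts separately. *)
Lemma normc_cintegral_le (F : T -> R[i]) : cmeasurable_fun setT F ->
  ((Normc.normc (cintegral mu setT F))%:E <=
   2%:E * \int[mu]_x (Normc.normc (F x))%:E)%E.
Proof.
move=> mF; have [->|Foo] := eqVneq (\int[mu]_x (Normc.normc (F x))%:E)%E +oo%E.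
  by rewrite gt0_muley ?leey// lte_fin.
have /(cintegrable_normc mF) [Ir Ij] : (\int[mu]_x (Normc.normc (F x))%:E < +oo)%E.
  by rewrite ltey.
have /measurable_EFinP mn := cmeasurable_normc mF.
have aux (h : T -> R) : mu.-integrable setT (EFin \o h) ->
    (forall x, `|h x| <= Normc.normc (F x)) ->
    (`|\int[mu]_x h x|%:E <= \int[mu]_x (Normc.normc (F x))%:E)%E.
  move=> Ih hF; rewrite EFin_normr_Rintegral//.
  apply: le_trans (le_abse_integral _ _ (measurable_int _ Ih)) _ => //.
  apply: ge0_le_integral => //.
  - by apply: measurableT_comp => //; exact: measurable_int Ih.
  - by move=> x _; rewrite /= lee_fin.
apply: (@le_trans _ _ (`|\int[mu]_x complex.Re (F x)|%:E + `|\int[mu]_x complex.Im (F x)|%:E)%E).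
  by rewrite -EFinD lee_fin; exact: normc_le_ReIm.
rewrite (_ : 2%:E = 1 + 1)%E// ge0_muleDl ?lee01// !mul1e leeD//.
  by apply: aux => // x; exact: normr_Re_le.
by apply: aux => // x; exact: normr_Im_le.
Qed.

Lemma cintegral_scale (phi : T -> T) (c : R) (F : T -> R[i]) :
  scales_measure mu phi c -> cmeasurable_fun setT F ->
  cintegral mu setT (fun x => F (phi x)) = c%:C * cintegral mu setT F.
Proof.
move=> sc [rF jF].
have aux (h : T -> R) : measurable_fun setT h ->
    \int[mu]_x h (phi x) = c * \int[mu]_x h x.
  move=> /measurable_EFinP mh; rewrite /Rintegral (integral_scale sc mh).
  have [_ c0 _] := sc.
  (* [fine] sends both infinities to 0, so the identity persists for divergent integrals. *)
  case: (\int[mu]_x (EFin \o h) x)%E => [r||] //=.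
    by rewrite gt0_muley ?lte_fin// mulr0.
  by rewrite gt0_muleNy ?lte_fin// mulr0.
have real_mul (z : R[i]) : c%:C * z = (c * complex.Re z) +i* (c * complex.Im z).
  by case: z => a b; apply/eqP; rewrite eq_complex ReM ImM /= !mul0r subr0 addr0 !eqxx.
by rewrite real_mul; congr (_ +i* _); [exact: (aux _ rF)|exact: (aux _ jF)].
Qed.

Lemma cintegral_mkcond (U : set T) (F : T -> R[i]) :
  cintegral mu U F = cintegral mu setT (fun x => (\1_U x)%:C * F x).
Proof.
rewrite /cintegral ![\int[mu]_(x in U) _]Rintegral_mkcond; congr (_ +i* _); apply: eq_Rintegral => x _;
  by rewrite /patch indicE ?ReM ?ImM; case: (x \in U); rewrite /= ?(mul1r, mul0r, subr0, addr0).
Qed.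

Lemma abse_integral_bigcup_le (A : (set T)^nat) (f : T -> \bar R) :
  trivIset setT A -> (forall k, measurable (A k)) ->
  mu.-integrable (\bigcup_k A k) f ->
  (`|\int[mu]_(x in \bigcup_k A k) f x| <= \sum_(k <oo) `|\int[mu]_(x in A k) f x|)%E.
Proof.
move=> tA mA If; rewrite integral_bigcup//.
have := integrable_summable tA mA If.
rewrite -(_ : [set _ | true] = setT); last exact/seteqP.
move=> /(@summable_eseries _ _ xpredT) ->.
set u := fun i => (\int[mu]_(x in A i) f x)%E.
(* The sum is now the difference of the series of positive and of negative parts, and these two add
   up to the series of absolute values. *)
apply: le_trans (lee_abs_sub _ _) _.
rewrite !gee0_abs ?nneseries_ge0// -nneseriesD//.
apply: lee_nneseries => [k _ _|k _]; first by rewrite adde_ge0.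
by rewrite -[X in (_ <= X)%E]/((abse \o u) k) fune_abse.
Qed.

(** Moduli are taken only after integrating over a piece: the oscillation inside each annulus stays
    available to the elliptic estimate. *)
Lemma normc_cintegral_bigcup_le (A : (set T)^nat) (F : T -> R[i]) :
  trivIset setT A -> (forall k, measurable (A k)) -> cintegrable mu setT F ->
  (forall x, ~ (\bigcup_k A k) x -> F x = 0) ->
  ((Normc.normc (cintegral mu setT F))%:E <=
   \sum_(k <oo) (2 * Normc.normc (cintegral mu (A k) F))%:E)%E.
Proof.
move=> tA mA [Ir Ij] F0.
have mU : measurable (\bigcup_k A k) by exact: bigcup_measurable.
have aux (h : T -> R) : mu.-integrable setT (EFin \o h) ->
    (forall x, ~ (\bigcup_k A k) x -> h x = 0) ->
    (`|\int[mu]_x h x|%:E <= \sum_(k <oo) (`|\int[mu]_(x in A k) h x|)%:E)%E.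
  move=> Ih h0; rewrite EFin_normr_Rintegral//.
  rewrite (_ : \int[mu]_x (h x)%:E = \int[mu]_(x in \bigcup_k A k) (h x)%:E)%E.
    apply: le_trans (abse_integral_bigcup_le tA mA _) _.
      exact: integrableS Ih.
    apply: lee_nneseries => // k _; rewrite EFin_normr_Rintegral//.
    exact: integrableS Ih.
  rewrite [RHS]integral_mkcond; apply: eq_integral => x _; rewrite /patch.
  by case: ifPn => // /negP; rewrite inE => /h0 ->.
apply: (@le_trans _ _ (`|\int[mu]_x complex.Re (F x)|%:E + `|\int[mu]_x complex.Im (F x)|%:E)%E).
  by rewrite -EFinD lee_fin; exact: normc_le_ReIm.
apply: le_trans (leeD (aux _ Ir _) (aux _ Ij _)) _.
- by move=> x /F0 ->.
- by move=> x /F0 ->.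
rewrite -nneseriesD//; apply: lee_nneseries => [k _ _|k _].
  by rewrite adde_ge0 ?lee_fin.
rewrite -EFinD lee_fin mulr_natl mulr2n lerD//.
  exact: (normr_Re_le (cintegral mu (A k) F)).
exact: (normr_Im_le (cintegral mu (A k) F)).
Qed.

End integrals.

End complex_functions.

(** * Dyadic annuli *)

Section dyadic_annuli.
Context {R : realType} {d : nat}.
Implicit Types (x : 'rV[R]_d) (f : 'rV[R]_d -> R[i]) (lam alpha : R).

Definition annulus lam : set 'rV[R]_d := [set x | reference_annulus (lam^-1 *: x)].

Lemma annulusE lam x : 0 < lam ->
  annulus lam x <-> lam * 4^-1 <= enorm x /\ enorm x < lam * 2^-1.
Proof.
move=> l0; rewrite /annulus /reference_annulus /= enormZ ?invr_ge0 ?(ltW l0)//.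
by rewrite ler_pdivlMl// ltr_pdivrMl//; split => [/andP[]|[-> ->]].
Qed.

Lemma measurable_reference_annulus : measurable (@reference_annulus R d).
Proof.
rewrite (_ : reference_annulus = (@enorm R d) @^-1` `[4^-1, 2^-1[); last first.
  by apply/seteqP; split=> x /=; rewrite in_itv.
by rewrite -[X in measurable X]setTI; apply: measurable_enorm.
Qed.

Lemma measurable_annulus lam : measurable (annulus lam).
Proof.
rewrite -[X in measurable X]setTI; apply: (measurable_scaler (lam^-1)) => //.
exact: measurable_reference_annulus.
Qed.

Lemma indic_annulusZ lam x : 0 < lam ->
  \1_(annulus lam) (lam *: x) = \1_reference_annulus x :> R.
Proof.
move=> l0; rewrite !indicE.
have E : annulus lam (lam *: x) = reference_annulus x.
  by rewrite /annulus /= scalerA mulVf ?gt_eqF// scale1r.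
suff -> : (lam *: x \in annulus lam) = (x \in reference_annulus) by [].
by apply/idP/idP => /set_mem h; apply/mem_set; [rewrite -E|rewrite E].
Qed.

Lemma reference_annulus_lty : (lebesgue_rV d (@reference_annulus R d) < +oo)%E.
Proof.
apply: le_lt_trans (lebesgue_rV_enorm_lt d 1).
apply: le_measure; rewrite ?inE; first exact: measurable_reference_annulus.
  rewrite (_ : mkset _ = (@enorm R d) @^-1` `]-oo, 1[).
    by rewrite -[X in measurable X]setTI; apply: measurable_enorm.
  by apply/seteqP; split=> x /=; rewrite in_itv.
by move=> x /sub_reference_annulus.
Qed.

(** For alpha >= 0 the smallest value occurs at radius 1/4; for alpha < 0 the power is already at
    least 1. *)
Lemma powR_reference_ge alpha x : reference_annulus x ->
  4 `^ (- `|alpha|) <= enorm x `^ alpha.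
Proof.
move=> /andP[x1 x2]; have x0 : 0 < enorm x by lra.
have [a0|a0] := leP 0 alpha.
  rewrite ger0_norm// -mulN1r powRrM powR_inv1//.
  by apply: ge0_ler_powR; rewrite ?nnegrE ?enorm_ge0.
have an : - `|alpha| <= 0 by rewrite oppr_le0.
apply: (@le_trans _ _ 1).
  by rewrite -[leRHS](powRr0 4) ler_powR// ler1n.
by rewrite -[leLHS](powRr0 (enorm x)) ger_powR ?(ltW a0)// x0/=; lra.
Qed.

Lemma normc_le_weight alpha lam f x : 0 < lam -> reference_annulus x ->
  Normc.normc (f (lam *: x)) <= 4 `^ `|alpha| * lam `^ (- alpha) *
    Normc.normc (rmul (fun xi => enorm xi `^ alpha) f (lam *: x)).
Proof.
move=> l0 xU; have := powR_reference_ge alpha xU.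
rewrite (powRN 4) => x0.
rewrite normc_rmul (ger0_norm (powR_ge0 _ _)) mulrA ler_peMl ?normc_ge0//.
rewrite enormZ ?(ltW l0)// powRM ?enorm_ge0 ?(ltW l0)//.
rewrite (powRN lam) -mulrA mulKf ?gt_eqF ?powR_gt0//.
by rewrite -ler_pdivrMl ?powR_gt0// mulr1.
Qed.

(** Hoelder on the reference annulus, followed by dilation. Summed over the annuli it gives the
    integrability of the truncated function, and it is also the whole estimate when q = oo. *)
Lemma integral_annulus_le (p : \bar R) alpha : (1 < p)%E ->
  exists2 C, 0 < C & forall lam f, 0 < lam -> cmeasurable_fun setT f ->
  (\int[lebesgue_rV d]_(x in annulus lam) (Normc.normc (f x))%:E <=
    (C * powR lam (d%:R - d%:R * fine p^-1%E - alpha))%:E *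
    cLnorm (lebesgue_rV d) p (rmul (fun xi => powR (enorm xi) alpha) f))%E.
Proof.
move=> p1; have [C C0 HC] := integral_normc_le_cLnorm p1
  measurable_reference_annulus reference_annulus_lty.
exists (4 `^ `|alpha| * (C + 1)).
  by rewrite mulr_gt0 ?powR_gt0// ltr_wpDl.
move=> lam f l0 mf; set F := rmul _ f.
have mF : cmeasurable_fun setT F.
  apply: cmeasurable_mul => //; apply: cmeasurable_real.
  by apply: (measurableT_comp (measurable_powR alpha)); exact: measurable_enorm.
have sc := scales_lebesgue_rV d l0.
have mFl : cmeasurable_fun setT (fun x => F (lam *: x)).
  exact: cmeasurable_comp mF (measurable_scaler _).
have /measurable_EFinP mn := cmeasurable_normc mf.
have -> : (\int[lebesgue_rV d]_(x in annulus lam) (Normc.normc (f x))%:E =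
    (lam ^+ d)%:E * \int[lebesgue_rV d]_(x in reference_annulus)
      (Normc.normc (f (lam *: x)))%:E)%E.
  rewrite integral_mkcond [in RHS]integral_mkcond.
  have := @ge0_integral_scale _ _ _ _ _ _ sc
    ((fun x => (Normc.normc (f x))%:E) \_ (annulus lam)).
  rewrite (_ : (fun x => _) \_ reference_annulus =
      (fun x => ((fun x => (Normc.normc (f x))%:E) \_ (annulus lam)) (lam *: x))); last first.
    apply/funext => x; rewrite /patch.
    have := indic_annulusZ x l0; rewrite !indicE.
    by do 2 case: (_ \in _) => //=; move=> /eqP; rewrite ?oner_eq0// eq_sym oner_eq0.
  move=> ->; first by rewrite muleA -EFinM -exprMn divff ?gt_eqF// expr1n mul1e.
  - apply/measurable_restrict => //; first exact: measurable_annulus.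
    by rewrite setTI; exact: measurable_funS mn.
  - by move=> x; rewrite /patch; case: ifP => _ //; rewrite lee_fin normc_ge0.
have h4 : 0 <= 4 `^ `|alpha| * lam `^ (- alpha) by rewrite mulr_ge0 ?powR_ge0.
have cp : (cLnorm (lebesgue_rV d) p (fun x => F (lam *: x)) <=
    ((lam^-1 ^+ d) `^ fine p^-1)%:E * cLnorm (lebesgue_rV d) p F)%E.
  have := cLnorm_le_scale (ltW p1) sc (ler01 : 0 <= 1 :> R) mFl mF.
  by rewrite mul1r; apply=> x; rewrite mul1r.
apply: (@le_trans _ _ ((lam ^+ d)%:E * ((4 `^ `|alpha| * lam `^ (- alpha))%:E *
    (C%:E * (((lam^-1 ^+ d) `^ fine p^-1)%:E * cLnorm (lebesgue_rV d) p F))))%E).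
  rewrite lee_wpmul2l ?lee_fin ?exprn_ge0 ?(ltW l0)//.
  apply: (@le_trans _ _ ((4 `^ `|alpha| * lam `^ (- alpha))%:E *
     \int[lebesgue_rV d]_(x in reference_annulus) (Normc.normc (F (lam *: x)))%:E)%E); last first.
    rewrite lee_wpmul2l ?lee_fin//; apply: le_trans (HC _ mFl) _.
    by rewrite lee_wpmul2l ?lee_fin.
  have /measurable_EFinP mnl := cmeasurable_normc mFl.
  have /measurable_EFinP mnf := cmeasurable_normc (cmeasurable_comp mf (measurable_scaler lam)).
  rewrite -ge0_integralZl//; last 3 first.
  - exact: measurable_reference_annulus.
  - exact: measurable_funS mnl.
  - by move=> x _; rewrite lee_fin normc_ge0.
  apply: ge0_le_integral => //.
  - exact: measurable_reference_annulus.
  - by move=> x _; rewrite lee_fin normc_ge0.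
  - exact: measurable_funS mnf.
  - by apply: emeasurable_funM => //; exact: measurable_funS mnl.
  - by move=> x xU; rewrite -EFinM lee_fin; exact: normc_le_weight.
rewrite !muleA -!EFinM lee_wpmul2r ?Lnorm_ge0// lee_fin.
have -> : d%:R - d%:R * fine p^-1 - alpha = d%:R + (- alpha) + (- d%:R * fine p^-1) by ring.
rewrite !powRD ?(gt_eqF l0) ?implybT// powR_mulrn ?(ltW l0)//.
rewrite (_ : (lam^-1 ^+ d) `^ _ = lam `^ (- d%:R * fine p^-1)); last first.
  by rewrite exprVn powRrM powR_invn// ltW.
set a := 4 `^ _; set b := lam `^ (- alpha); set c := lam `^ (- d%:R * _).
have -> : lam ^+ d * (a * b) * C * c = a * C * (lam ^+ d * b * c) by ring.
rewrite ler_wpM2r ?mulr_ge0 ?exprn_ge0 ?powR_ge0 ?(ltW l0)//.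
by rewrite ler_wpM2l ?powR_ge0// lerDl.
Qed.

End dyadic_annuli.

(** * Dyadic tiling of a punctured ball *)

Section dyadic_decomposition.
Context {R : realType} {d : nat}.
Implicit Types (x : 'rV[R]_d) (rho : R).

(** The factor 2 compensates for the outer radius 1/2 of the reference annulus: the k-th annulus has
    outer radius rho 2^-k. *)
Definition scale_of rho k : R := 2 * rho * 2^-1 ^+ k.

Lemma scale_of_gt0 rho k : 0 < rho -> 0 < scale_of rho k.
Proof. by move=> r0; rewrite mulr_gt0 ?exprn_gt0 ?invr_gt0// mulr_gt0. Qed.

Lemma scale_ofS rho k : scale_of rho k.+1 = scale_of rho k * 2^-1.
Proof. by rewrite /scale_of exprSr mulrA. Qed.

Lemma scale_of_le rho j k : 0 < rho -> (j <= k)%N -> scale_of rho k <= scale_of rho j.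
Proof.
move=> r0 jk; rewrite ler_wpM2l ?mulr_ge0 ?(ltW r0)//.
by rewrite ler_wiXn2l// ?invr_ge0// invf_le1// ler1n.
Qed.

Lemma trivIset_annuli rho : 0 < rho ->
  trivIset setT (fun k => @annulus R d (scale_of rho k)).
Proof.
move=> r0; apply: ltn_trivIset => k j jk.
apply/seteqP; split=> // x /= [].
move=> /(annulusE _ (scale_of_gt0 _ r0))[xj _] /(annulusE _ (scale_of_gt0 _ r0))[_ xk].
suff : enorm x < enorm x by rewrite ltxx.
by have := scale_of_le r0 jk; rewrite (scale_ofS _ j); lra.
Qed.

Lemma bigcup_annuli rho x : 0 < rho ->
  (\bigcup_k annulus (scale_of rho k)) x <-> x != 0 /\ enorm x < rho.
Proof.
move=> r0; split.
  move=> [k _ /(annulusE _ (scale_of_gt0 _ r0))[x1 x2]]; split.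
    apply: contraTneq x1 => ->; rewrite enorm0 -ltNge.
    by rewrite mulr_gt0 ?scale_of_gt0.
  have : scale_of rho k <= 2 * rho.
    by rewrite (le_trans (scale_of_le r0 (leq0n k)))// /scale_of expr0 mulr1.
  by move: x2; lra.
move=> [/enorm_gt0 x0 xr].
have exk : exists k, scale_of rho k * 4^-1 <= enorm x.
  have [N HN] : exists N : nat, rho / enorm x < N%:R.
    by exists (Num.trunc (rho / enorm x)).+1; exact: truncnS_gt.
  exists N; have N2 : (N%:R : R) <= 2 ^+ N by rewrite -natrX ler_nat ltnW// ltn_expl.
  have p2 : 0 < 2 ^+ N :> R by rewrite exprn_gt0.
  rewrite /scale_of exprVn mulrAC ler_pdivrMr//.
  move: HN; rewrite ltr_pdivrMr// => HN.
  have : N%:R * enorm x <= 2 ^+ N * enorm x by rewrite ler_wpM2r ?enorm_ge0.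
  lra.
(* The inner radius at one index is the outer radius at the next, so minimality gives the upper
   bound; at index 0 it is |x| < rho. *)
case: (ex_minnP exk) => m mP mmin; exists m => //.
apply/(annulusE _ (scale_of_gt0 _ r0)); split=> //.
case: m mP mmin => [|m] mP mmin.
  by rewrite /scale_of expr0; lra.
rewrite scale_ofS ltNge; apply/negP => h.
have : (m.+1 <= m)%N by apply: mmin; lra.
by rewrite ltnn.
Qed.

Lemma dyadic_series_le (delta rho : R) : 0 < delta -> 0 < rho ->
  exists2 G, 0 < G & forall (u : nat -> \bar R) (C : R) (B : \bar R),
    (0 <= C) -> (0 <= B)%E -> (forall k, 0 <= u k)%E ->
    (forall k, u k <= (C * powR (scale_of rho k) delta)%:E * B)%E ->
    (\sum_(k <oo) u k <= (C * G)%:E * B)%E.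
Proof.
move=> d0 r0; set r : R := 2^-1 `^ delta.
have rr : 0 < r < 1.
  have E1 : 1 `^ delta = 1 :> R by rewrite powR1.
  rewrite powR_gt0 ?invr_gt0//= -[ltRHS]E1.
  by apply: gt0_ltr_powR; rewrite ?nnegrE ?invr_ge0// invf_lt1// ltr1n.
have [r0' r1] := andP rr.
(* The full geometric series of ratio 2^-delta; delta > 0 makes the ratio less than 1. *)
exists ((2 * rho) `^ delta * (1 - r)^-1).
  by rewrite mulr_gt0 ?invr_gt0 ?subr_gt0 ?powR_gt0// mulr_gt0.
move=> u C B C0 B0 u0 uB.
apply: lime_le; first by apply: is_cvg_nneseries => k _ _.
apply: nearW => n.
apply: (@le_trans _ _ (\sum_(0 <= k < n) (C * ((2 * rho) `^ delta * r ^+ k))%:E * B)%E).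
  apply: lee_sum => k _; apply: le_trans (uB k) _; rewrite lee_wpmul2r// lee_fin ler_wpM2l//.
  rewrite /scale_of powRM ?mulr_ge0 ?exprn_ge0 ?invr_ge0 ?(ltW r0)//.
  have -> : (2^-1 ^+ k) `^ delta = r ^+ k.
    have h0 : 0 <= 2^-1 :> R by rewrite invr_ge0.
    by rewrite -(powR_mulrn k (ltW r0')) -(powR_mulrn k h0) -!powRrM mulrC.
  exact: lexx.
rewrite -ge0_sume_distrl => [|k _]; last first.
  by rewrite lee_fin !mulr_ge0 ?powR_ge0 ?exprn_ge0 ?(ltW r0').
rewrite lee_wpmul2r// sumEFin lee_fin -mulr_sumr ler_wpM2l//.
rewrite -mulr_sumr ler_wpM2l ?powR_ge0//.
rewrite big_mkord -(ler_pM2r (x := 1 - r)) ?subr_gt0// mulVf ?gt_eqF ?subr_gt0//.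
by have := subrX1 r n; have := exprn_gt0 n r0'; lra.
Qed.

End dyadic_decomposition.

(** * The estimate on one annulus *)

Section single_annulus.
Context {R : realType} {d : nat}.
Implicit Types (P S : {poly R}) (x : 'rV[R]_d) (f : 'rV[R]_d -> R[i]).

Lemma polyfun_det_hessian (f : 'rV[R]_d -> R) : polyfun f ->
  polyfun (fun x => \det (hessian f x)).
Proof.
move=> pf; apply: polyfun_det => i j.
rewrite (_ : (fun x => _) = partial i (partial j f)).
  by do 2 apply: polyfun_partial.
by apply/funext => x; rewrite mxE.
Qed.

Lemma polyfun_det_radial P : P \Po - 'X = P ->
  polyfun (fun x : 'rV[R]_d => \det (hessian (radial_phase P) x)).
Proof.
move=> evenP; rewrite (radial_phaseE evenP).
exact/polyfun_det_hessian/polyfun_horner/polyfun_dotp.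
Qed.

Lemma measurable_Lambda P : P \Po - 'X = P -> measurable_fun setT (@Lambda R d P).
Proof.
move=> evenP; apply: (measurableT_comp (measurable_powR _)).
apply: measurableT_comp => //.
by apply: polyfun_measurable; exact: polyfun_det_radial.
Qed.

Lemma measurable_radial_phase P : P \Po - 'X = P ->
  measurable_fun setT (@radial_phase R d P).
Proof.
move=> /radial_phaseE ->; apply: polyfun_measurable.
exact/polyfun_horner/polyfun_dotp.
Qed.

(** The exponent cancels the root d+2 in [Lambda] and leaves |det|^(1/(dq)). Its d-th root undoes
    the d-th power in the determinant bound, so M / lam^2 appears to the power exactly 1/q. *)
Lemma powR_Lambda_le P n (lam q : R) x : (0 < d)%N -> P \Po - 'X = P ->
  (forall i, 0 <= P`_i) -> (size P <= n)%N -> 0 < lam -> 0 < q -> annulus lam x ->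
  powR (Lambda P x) (d.+2%:R / (d%:R * q)) <=
  (d`!%:R * (64 * n%:R ^+ 2)) `^ q^-1 *
    (nonconst_mass (even_poly P) (lam ^+ 2) / lam ^+ 2) `^ q^-1.
Proof.
move=> d0 evenP P0 Pn l0 q0 xA.
have S0 k : 0 <= (even_poly P)`_k by rewrite coef_even_poly.
have Sn : (size (even_poly P) <= n)%N by exact: leq_trans (size_even_poly_le P) Pn.
have := det_hessian_le d0 S0 Sn l0 xA; rewrite -(radial_phaseE evenP).
set M := nonconst_mass _ _ => detle.
have M0 : 0 <= M by apply: nonconst_mass_ge0 => //; rewrite sqr_ge0.
have Ml0 : 0 <= M / lam ^+ 2 by rewrite divr_ge0// sqr_ge0.
have c0 : 0 <= d`!%:R * (64 * n%:R ^+ 2) :> R by rewrite mulr_ge0// mulr_ge0// sqr_ge0.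
rewrite -powRM// /Lambda -powRrM.
have d00 : d%:R != 0 :> R by rewrite pnatr_eq0 -lt0n.
have d20 : d.+2%:R != 0 :> R by rewrite pnatr_eq0.
rewrite (_ : d.+2%:R^-1 * _ = d%:R^-1 * q^-1); last first.
  by rewrite mulrA mulVf// mul1r invfM.
have X0 := mulr_ge0 c0 Ml0.
rewrite (mulrA d`!%:R) in detle; set X := _ * (M / _) in X0 detle *.
rewrite powRrM; apply: ge0_ler_powR; rewrite ?nnegrE ?powR_ge0 ?invr_ge0 ?(ltW q0)//.
apply: (@le_trans _ _ ((X ^+ d) `^ d%:R^-1)).
  by apply: ge0_ler_powR; rewrite ?nnegrE ?invr_ge0 ?exprn_ge0.
by rewrite -powR_mulrn// -powRrM mulfV// powRr1.
Qed.

Lemma cmeasurable_extension_integrand (Phi : 'rV[R]_d -> R) f :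
  measurable_fun setT Phi -> cmeasurable_fun setT f ->
  cmeasurable_fun setT (fun z : (measurableTypeR R * 'rV[R]_d) * 'rV[R]_d =>
    expi (z.1.1 * Phi z.2 + dotp z.1.2 z.2) * f z.2).
Proof.
move=> mPhi mf; apply: cmeasurable_mul; last exact: cmeasurable_comp mf measurable_snd.
apply: cmeasurable_expi; apply: measurable_funD.
  apply: measurable_funM.
    exact: (measurableT_comp measurable_fst measurable_fst).
  exact: (measurableT_comp mPhi measurable_snd).
rewrite /dotp; apply: measurable_sum => i; apply: measurable_funM.
  apply: (measurableT_comp (measurable_coord i)).
  exact: (measurableT_comp measurable_snd measurable_fst).
exact: (measurableT_comp (measurable_coord i) measurable_snd).
Qed.

Lemma extension_mkcond (U : set 'rV[R]_d) (Phi : 'rV[R]_d -> R) f z :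
  extension U Phi f z = extension setT Phi (rmul \1_U f) z.
Proof.
rewrite /extension cintegral_mkcond; congr cintegral; apply/funext => x.
by rewrite /rmul mulrCA.
Qed.

Lemma cmeasurable_extension (U : set 'rV[R]_d) (Phi : 'rV[R]_d -> R) f :
  measurable U -> measurable_fun setT Phi -> cmeasurable_fun setT f ->
  cmeasurable_fun setT (extension U Phi f).
Proof.
move=> mU mPhi mf.
rewrite (_ : extension U Phi f = extension setT Phi (rmul \1_U f)); last first.
  by apply/funext => z; exact: extension_mkcond.
have mUf : cmeasurable_fun setT (rmul \1_U f).
  by apply: cmeasurable_mul => //; apply: cmeasurable_real; exact: measurable_indic.
exact: (cmeasurable_cintegral_param (lebesgue_rV d)
  (cmeasurable_extension_integrand mPhi mUf)).
Qed.

Lemma extension_scale (Phi Psi : 'rV[R]_d -> R) f (lam M t : R) x :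
  0 < lam -> measurable_fun setT Phi -> cmeasurable_fun setT f ->
  (forall y, Phi (lam *: y) = M * Psi y) ->
  extension (annulus lam) Phi f (t, x) =
  (lam ^+ d)%:C * extension reference_annulus Psi (fun y => f (lam *: y)) (M * t, lam *: x).
Proof.
move=> l0 mPhi mf PhiE.
have mUf : cmeasurable_fun setT (rmul \1_(annulus lam) f).
  apply: cmeasurable_mul => //; apply: cmeasurable_real; apply: measurable_indic.
  exact: measurable_annulus.
have mF : cmeasurable_fun setT
    (fun y => expi (t * Phi y + dotp x y) * rmul \1_(annulus lam) f y).
  exact: (cmeasurable_comp (cmeasurable_extension_integrand mPhi mUf) (measurable_pair1 (t, x))).
have E := cintegral_scale (scales_lebesgue_rV d l0) mF.
rewrite extension_mkcond [in RHS]extension_mkcond /extension /=.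
have {E} -> : cintegral (lebesgue_rV d) setT
    (fun y => expi (t * Phi y + dotp x y) * rmul \1_(annulus lam) f y) =
  (lam ^+ d)%:C * cintegral (lebesgue_rV d) setT
    (fun y => expi (t * Phi (lam *: y) + dotp x (lam *: y)) * rmul \1_(annulus lam) f (lam *: y)).
  rewrite E mulrA -rmorphM /= -exprMn mulfV ?gt_eqF// expr1n.
  by rewrite mul1r.
congr (_ * cintegral _ _ _); apply/funext => y.
rewrite /rmul indic_annulusZ// PhiE; congr (expi _ * _).
rewrite mulrA [t * M]mulrC; congr (_ + _).
by rewrite /dotp; apply: eq_bigr => i _; rewrite !mxE; ring.
Qed.

End single_annulus.

Section annulus_estimate.
Context {R : realType} {d : nat}.
Implicit Types (P S : {poly R}) (x : 'rV[R]_d) (f : 'rV[R]_d -> R[i]).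

Lemma nonconst_massE S (r : R) : nonconst_mass S r = S.[r] - S.[0].
Proof.
rewrite /nonconst_mass !horner_coef -sumrB big_mkcond; apply: eq_bigr => j _.
case: ifPn => [j0|]; first by rewrite expr0n gtn_eqF// mulr0 subr0.
by rewrite -eqn0Ngt => /eqP ->; rewrite !expr0 subrr.
Qed.

Lemma cmeasurable_weight (alpha : R) f : cmeasurable_fun setT f ->
  cmeasurable_fun setT (rmul (fun xi => powR (enorm xi) alpha) f).
Proof.
move=> mf; apply: cmeasurable_mul => //; apply: cmeasurable_real.
by apply: (measurableT_comp (measurable_powR alpha)); exact: measurable_enorm.
Qed.

Lemma annulus_estimate (p : \bar R) (q : R) (alpha : R) (n : nat) :
  (0 < d)%N -> (1 <= p)%E -> 1 <= q -> elliptic_extension d p q%:E ->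
  exists2 C, 0 < C & forall lam P f, 0 < lam -> P \Po - 'X = P ->
    (forall i, 0 <= P`_i) -> (size P <= n)%N -> cmeasurable_fun setT f ->
  (cLnorm (spacetime_measure R d) q%:E
     (extension (annulus lam) (radial_phase P)
       (rmul (fun xi => powR (Lambda P xi) (d.+2%:R / (d%:R * q))) f)) <=
    (C * powR lam (d%:R - d.+2%:R / q - d%:R * fine p^-1%E - alpha))%:E *
    cLnorm (lebesgue_rV d) p (rmul (fun xi => powR (enorm xi) alpha) f))%E.
Proof.
move=> d0 p1 q1 [N HN].
have q0 : 0 < q by rewrite (lt_le_trans ltr01).
have [A [eps [eps01 ellip]]] := @annulus_elliptic R d N n.
have [CE [CE0 HE]] := HN A eps eps01.
pose cL := (d`!%:R * (64 * n%:R ^+ 2)) `^ q^-1 : R.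
(* Adding 1 keeps the constant positive when n = 0, where [cL] vanishes. *)
exists (CE * (cL + 1) * 4 `^ `|alpha|).
  by rewrite mulr_gt0 ?powR_gt0// mulr_gt0// ltr_wpDl// powR_ge0.
move=> lam P f l0 evenP P0 Pn mf.
set s := d.+2%:R / (d%:R * q); set F := rmul (fun xi => powR (enorm xi) alpha) f.
set w := rmul (fun xi => powR (Lambda P xi) s) f.
have mF : cmeasurable_fun setT F by exact: cmeasurable_weight.
have mw : cmeasurable_fun setT w.
  apply: cmeasurable_mul => //; apply: cmeasurable_real.
  by apply: (measurableT_comp (measurable_powR s)); exact: measurable_Lambda.
have mA := @measurable_annulus R d lam.
have mU := @measurable_reference_annulus R d.
have mphase := measurable_radial_phase (d := d) evenP.
have mext := cmeasurable_extension mA mphase mw.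
pose S := even_poly P.
have S0 k : 0 <= S`_k by rewrite coef_even_poly.
have Sn : (size S <= n)%N by exact: leq_trans (size_even_poly_le P) Pn.
pose M := nonconst_mass S (lam ^+ 2).
have M0 : 0 <= M by apply: nonconst_mass_ge0 => //; rewrite sqr_ge0.
have wle x : annulus lam x -> Normc.normc (w x) <=
    cL * (M / lam ^+ 2) `^ q^-1 * Normc.normc (f x).
  move=> xA; rewrite normc_rmul (ger0_norm (powR_ge0 _ _)) ler_wpM2r ?normc_ge0//.
  exact: powR_Lambda_le.
have Cge0 (b : R) : 0 <= b -> 0 <= CE * (cL + 1) * 4 `^ `|alpha| * b.
  by move=> b0; rewrite !mulr_ge0 ?powR_ge0 ?(ltW CE0)// addr_ge0 ?powR_ge0.
(* A constant phase cannot be normalized, but then [wle] forces the weighted function to vanish on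
   the annulus. *)
have [M00|Mneq0] := eqVneq M 0.
  have ext0 z : extension (annulus lam) (radial_phase P) w z = 0.
    rewrite extension_mkcond /extension (_ : (fun xi => _) = fun=> 0).
      rewrite /cintegral /Rintegral /= !integral0_eq//.
    apply/funext => x; rewrite [rmul _ _ _](_ : _ = 0) ?mulr0//.
    rewrite /rmul indicE; case: (boolP (x \in annulus lam)) => [|_]; last by rewrite mul0r.
    rewrite inE => /wle; rewrite M00 mul0r powR0 ?invr_eq0 ?gt_eqF// mulr0 mul0r => w0.
    suff -> : w x = 0 by rewrite mulr0.
    by apply: Normc.eq0_normc; apply/eqP; rewrite eq_le w0 normc_ge0.
  apply: (@le_trans _ _ 0%E).
    have := @cLnorm_le _ _ _ (spacetime_measure R d) q%:E 0 _ _ _ (lexx 0) mext mext.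
    rewrite mul0e; apply; first by rewrite lee_fin.
    by move=> z; rewrite ext0 /= expr0n /= addr0 sqrtr0 mulr0.
  by rewrite mule_ge0 ?Lnorm_ge0// lee_fin Cge0 ?powR_ge0.
have Mgt0 : 0 < M by rewrite lt0r Mneq0.
(* This is S(lam^2 r) / M, whose nonconstant mass at 1 is 1. *)
pose T := \poly_(j < size S) (S`_j * (lam ^+ 2) ^+ j / M).
have TE r : M * T.[r] = S.[lam ^+ 2 * r].
  rewrite horner_poly mulr_sumr horner_coef; apply: eq_bigr => j _.
  rewrite [(lam ^+ 2 * r) ^+ j]exprMn; set a := (lam ^+ 2) ^+ j; set b := r ^+ j.
  by rewrite [RHS]mulrA [_ / M * b]mulrAC mulrC mulfVK.
have T0 k : 0 <= T`_k.
  by rewrite coef_poly; case: ifP => _ //; rewrite divr_ge0// mulr_ge0// exprn_ge0// sqr_ge0.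
have Tn : (size T <= n)%N by exact: leq_trans (size_poly _ _) Sn.
have T1 : nonconst_mass T 1 = 1.
  by apply: (mulfI Mneq0); rewrite mulr1 nonconst_massE mulrBr !TE mulr1 mulr0 -nonconst_massE.
pose Psi (y : 'rV[R]_d) := T.[dotp y y].
have PsiE y : radial_phase P (lam *: y) = M * Psi y.
  by rewrite (radial_phaseE evenP) dotpZ TE.
have mPsi : measurable_fun setT Psi.
  apply: polyfun_measurable; exact/polyfun_horner/polyfun_dotp.
pose h (y : 'rV[R]_d) := w (lam *: y).
have mh : cmeasurable_fun setT h by exact: cmeasurable_comp mw (measurable_scaler _).
have mUh : cmeasurable_fun setT (rmul \1_reference_annulus h).
  by apply: cmeasurable_mul => //; apply: cmeasurable_real; exact: measurable_indic.
have mext2 := cmeasurable_extension mU mPsi mh.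
(* The map (t, x) -> (M t, lam x) has the constant M^-1 lam^-d; its power 1/q supplies the M^(-1/q)
   that cancels the M^(1/q) coming from [Lambda]. *)
have sc := scales_measure_prod (scales_lebesgue_measure Mgt0) (scales_lebesgue_rV d l0).
have ld0 : 0 <= lam ^+ d by rewrite exprn_ge0 ?(ltW l0).
have step1 := @cLnorm_le_scale _ _ R _ q%:E _ _ (lam ^+ d) _ _ _ sc ld0 mext mext2.
apply: le_trans (step1 _ _) _; first by rewrite lee_fin.
  move=> [t x]; rewrite (extension_scale t x l0 mphase mw PsiE).
  by rewrite Normc.normcM normc_real ger0_norm.
have step2 := HE _ _ mU (@sub_reference_annulus R d) (ellip T T0 Tn T1) h.
have step3 : (cLnorm (lebesgue_rV d) p (rmul \1_reference_annulus h) <=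
    (cL * (M / lam ^+ 2) `^ q^-1 * (4 `^ `|alpha| * lam `^ (- alpha)) *
      (lam^-1 ^+ d) `^ fine p^-1)%:E * cLnorm (lebesgue_rV d) p F)%E.
  have k0 : 0 <= cL * (M / lam ^+ 2) `^ q^-1 by rewrite mulr_ge0 ?powR_ge0.
  apply: (cLnorm_le_scale p1 (scales_lebesgue_rV d l0)) => //.
    by rewrite mulr_ge0// mulr_ge0 ?powR_ge0.
  move=> x; rewrite normc_rmul indicE.
  case: (boolP (x \in reference_annulus)) => [|_]; last first.
    by rewrite normr0 mul0r mulr_ge0 ?normc_ge0// mulr_ge0// mulr_ge0 ?powR_ge0.
  rewrite inE normr1 mul1r -mulrA => xU.
  apply: (@le_trans _ _ (cL * (M / lam ^+ 2) `^ q^-1 * Normc.normc (f (lam *: x)))).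
    by apply: wle; rewrite /annulus /= scalerA mulVf ?gt_eqF// scale1r.
  by rewrite ler_wpM2l//; exact: normc_le_weight.
set c2 := (M^-1 * _).
apply: (@le_trans _ _ ((lam ^+ d * c2 `^ fine (q%:E)^-1%E)%:E *
  (CE%:E * ((cL * (M / lam ^+ 2) `^ q^-1 * (4 `^ `|alpha| * lam `^ (- alpha)) *
      (lam^-1 ^+ d) `^ fine p^-1%E)%:E * cLnorm (lebesgue_rV d) p F)))%E).
  rewrite lee_wpmul2l ?lee_fin ?mulr_ge0 ?powR_ge0//.
  apply: le_trans (step2 _) _.
    by split; [exact: measurable_funS mh.1|exact: measurable_funS mh.2].
  by rewrite lee_wpmul2l ?lee_fin ?(ltW CE0).
rewrite !muleA -!EFinM lee_wpmul2r ?Lnorm_ge0// lee_fin inver gt_eqF//=.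
rewrite /c2 powRM ?invr_ge0 ?exprn_ge0 ?invr_ge0 ?(ltW Mgt0) ?(ltW l0)//.
rewrite powRM ?invr_ge0 ?exprn_ge0 ?(ltW Mgt0) ?(ltW l0)//.
set bM := M `^ q^-1; set bp := fine _.
have -> : M^-1 `^ q^-1 = bM^-1.
  by rewrite -powRN -[in RHS]mulN1r powRrM powR_inv1 ?(ltW Mgt0).
have bM0 : bM != 0 by rewrite gt_eqF// powR_gt0.
have lamX (k : nat) (r : R) : (lam^-1 ^+ k) `^ r = lam `^ (- k%:R * r).
  by rewrite exprVn powRrM powR_invn// ltW.
have -> : (lam ^+ 2)^-1 `^ q^-1 = lam `^ (- 2%:R * q^-1) by rewrite -exprVn lamX.
rewrite !lamX -powR_mulrn ?(ltW l0)//.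
(* In order: frequency Jacobian, spatial dilation, bound on [Lambda], weight, and dilation of the
   L^p norm. *)
have -> : d%:R - d.+2%:R / q - d%:R * bp - alpha =
    d%:R + (- d%:R * q^-1) + (- 2%:R * q^-1) + (- alpha) + (- d%:R * bp).
  by rewrite -addn2 natrD; ring.
rewrite !powRD ?(gt_eqF l0) ?implybT//.
set x1 := lam `^ _; set x2 := lam `^ _; set x3 := lam `^ _; set x4 := lam `^ _.
set x5 := lam `^ _; set a := 4 `^ _.
have -> : x1 * (bM^-1 * x2) * CE * (cL * (bM * x3) * (a * x4) * x5) =
    CE * cL * a * (x1 * x2 * x3 * x4 * x5) by field.
  by rewrite ler_wpM2r ?mulr_ge0 ?powR_ge0// ler_wpM2r ?powR_ge0// ler_wpM2l ?(ltW CE0)// lerDl.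
by rewrite invr_ge0 ltW.
Qed.

End annulus_estimate.

(** * Summation over the annuli *)

Section multiplier.
Context {R : realType} {d : nat}.
Implicit Types (P : {poly R}) (x : 'rV[R]_d) (f g : 'rV[R]_d -> R[i]).

Lemma expiD (a b : R) : expi (a + b) = expi a * expi b.
Proof.
by apply/eqP; rewrite /expi eq_complex /= cosD sinD eqxx /= addrC eqxx.
Qed.

Lemma cintegral_eq_off0 f g : (0 < d)%N ->
  cmeasurable_fun setT f -> cmeasurable_fun setT g ->
  (forall x, x != 0 -> f x = g x) ->
  cintegral (lebesgue_rV d) setT f = cintegral (lebesgue_rV d) setT g.
Proof.
move=> d0 [rf jf] [rg jg] fg.
have aux (h k : 'rV[R]_d -> R) : measurable_fun setT h -> measurable_fun setT k ->
    (forall x, x != 0 -> h x = k x) ->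
    \int[lebesgue_rV d]_x h x = \int[lebesgue_rV d]_x k x.
  move=> mh mk hk; rewrite /Rintegral; congr fine; apply: ae_eq_integral => //.
  - exact/measurable_EFinP.
  - exact/measurable_EFinP.
  - exists [set 0]; split; [exact: measurable_rV_set0|exact: lebesgue_rV_set0|].
    move=> x /= nx; apply: contrapT => /eqP x0; apply: nx => _.
    by rewrite /= hk.
by congr (_ +i* _); apply: aux => // x /fg ->.
Qed.

(** The Hessian determinant is a polynomial, hence bounded on the ball carrying [g], and s >= 0
    transfers the bound to the symbol. *)
Lemma integral_normc_Lambda_lty P (s rho : R) g : 0 <= s -> P \Po - 'X = P ->
  cmeasurable_fun setT g -> (forall x, rho <= enorm x -> g x = 0) ->
  (\int[lebesgue_rV d]_x (Normc.normc (g x))%:E < +oo)%E ->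
  (\int[lebesgue_rV d]_x
    (Normc.normc (rmul (fun xi => powR (Lambda P xi) s) g x))%:E < +oo)%E.
Proof.
move=> s0 evenP mg gsupp goo; set m := fun xi => powR (Lambda P xi) s.
have mm : measurable_fun setT m.
  by apply: (measurableT_comp (measurable_powR s)); exact: measurable_Lambda.
have mmg : cmeasurable_fun setT (rmul m g).
  by apply: cmeasurable_mul => //; exact: cmeasurable_real.
have [c c0 detc] := polyfun_bounded rho (polyfun_det_radial (d := d) evenP).
pose L := (c `^ d.+2%:R^-1) `^ s.
have mL x : enorm x < rho -> m x <= L.
  move=> xr; apply: ge0_ler_powR; rewrite ?nnegrE ?powR_ge0//.
  apply: ge0_ler_powR; rewrite ?nnegrE ?invr_ge0 ?(ltW c0)//.
  by apply: detc => i; rewrite (le_trans (coord_le_enorm _ _))// ltW.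
have m0 x : 0 <= m x by exact: powR_ge0.
have L0 : 0 <= L by exact: powR_ge0.
clearbody m L.
have /measurable_EFinP mng := cmeasurable_normc mg.
have /measurable_EFinP mnmg := cmeasurable_normc mmg.
apply: (@le_lt_trans _ _ (L%:E * \int[lebesgue_rV d]_x (Normc.normc (g x))%:E)%E).
  rewrite -ge0_integralZl//; last first.
    by move=> x _; rewrite lee_fin normc_ge0.
  apply: ge0_le_integral => //.
  - by move=> x _; rewrite lee_fin normc_ge0.
  - by apply: emeasurable_funM => //; exact: mng.
  move=> x _; rewrite normc_rmul (ger0_norm (m0 x)) -EFinM lee_fin.
  have [xr|/gsupp ->] := ltP (enorm x) rho; last by rewrite Normc.normc0 !mulr0.
  by rewrite ler_wpM2r ?normc_ge0// mL.
by rewrite lte_mul_pinfty// lee_fin.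
Qed.

(** At a fixed time the witness is e^(itP) [g], with the same modulus as [g]. Replacing [f] by [g]
    does not change the extension at any point, since the origin is a null set. *)
Lemma fourier_multiplier_extension P (s rho : R) f g :
  (0 < d)%N -> 0 <= s -> P \Po - 'X = P ->
  cmeasurable_fun setT f -> cmeasurable_fun setT g ->
  (forall x, x != 0 -> f x = g x) -> (forall x, rho <= enorm x -> g x = 0) ->
  (\int[lebesgue_rV d]_x (Normc.normc (g x))%:E < +oo)%E ->
  forall t : R, fourier_multiplier (fun xi => powR (Lambda P xi) s)
    (fun x => extension setT (radial_phase P) f (t, x))
    (fun x => extension setT (radial_phase P)
      (rmul (fun xi => powR (Lambda P xi) s) g) (t, x)).
Proof.
move=> d0 s0 evenP mf mg fg gsupp goo t.
have mphase := measurable_radial_phase (d := d) evenP.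
set m := fun xi => powR (Lambda P xi) s.
have mm : measurable_fun setT m.
  by apply: (measurableT_comp (measurable_powR s)); exact: measurable_Lambda.
pose gt x := expi (t * radial_phase P x) * g x.
have mgt : cmeasurable_fun setT gt.
  apply: cmeasurable_mul => //; apply: cmeasurable_expi.
  by apply: measurable_funM => //; exact: measurable_cst.
have ngt x : Normc.normc (gt x) = Normc.normc (g x).
  by rewrite Normc.normcM normc_expi mul1r.
have mmgt : cmeasurable_fun setT (rmul m gt).
  by apply: cmeasurable_mul => //; exact: cmeasurable_real.
exists gt; split.
- by apply: cintegrable_normc => //; under eq_integral do rewrite ngt.
- apply: cintegrable_normc => //.
  apply: (integral_normc_Lambda_lty (rho := rho)) => // [x /gsupp gx|].
    by rewrite /gt gx mulr0.
  by under eq_integral do rewrite ngt.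
- move=> x; apply: cintegral_eq_off0 => //.
  + exact: (cmeasurable_comp (cmeasurable_extension_integrand mphase mf) (measurable_pair1 (t, x))).
  + apply: cmeasurable_mul => //; apply: cmeasurable_expi.
    by rewrite /dotp; apply: measurable_sum => i; apply: measurable_funM;
      [exact: measurable_cst|exact: measurable_coord].
  + by move=> xi /fg -> /=; rewrite /gt mulrA -expiD addrC.
- move=> x; congr cintegral; apply/funext => xi /=.
  by rewrite addrC expiD /rmul /gt !mulrA; congr (_ * _); rewrite -!mulrA; congr (_ * _); rewrite mulrC.
Qed.

End multiplier.

(** * Conjugate exponents *)

Section conjugate_exponents.
Context {R : realType}.

(** Conjugation is an involution, so [p] is the conjugate of [x] and the two inverses add up to
    1. *)
Lemma inve_hoelder_conjugate (p : \bar R) (x : R) : 1 < x ->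
  hoelder_conjugate p = x%:E -> p^-1%E = (1 - x^-1)%:E.
Proof.
move=> x1 px; have x0 : 0 < x by rewrite (lt_trans ltr01).
have := @hoelder_conjugate_eq1 R x%:E (ltNyr _); rewrite eqe gt_eqF// => /(_ isT).
rewrite -px hoelder_conjugateK px inver gt_eqF// => /eqP.
case: (p^-1)%E => [y| |] //=.
by rewrite -EFinD eqe => /eqP <-; rewrite addrAC subrr add0r.
Qed.

End conjugate_exponents.

Section dyadic_bounds.
Context {R : realType} {d : nat}.
Implicit Types (f : 'rV[R]_d -> R[i]).

Lemma integral_bigcup_annuli_le (p : \bar R) (alpha rho : R) :
  (1 < p)%E -> 0 < rho -> alpha < d%:R - d%:R * fine p^-1%E ->
  exists2 C, 0 < C & forall f, cmeasurable_fun setT f ->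
  (\int[lebesgue_rV d]_(x in \bigcup_k annulus (scale_of rho k)) (Normc.normc (f x))%:E <=
    C%:E * cLnorm (lebesgue_rV d) p (rmul (fun xi => powR (enorm xi) alpha) f))%E.
Proof.
move=> p1 r0 al; have [C C0 HC] := @integral_annulus_le R d p alpha p1.
have dl : 0 < d%:R - d%:R * fine p^-1%E - alpha by rewrite subr_gt0.
have [G G0 HG] := dyadic_series_le dl r0.
exists (C * G); first exact: mulr_gt0.
move=> f mf; have /measurable_EFinP mn := cmeasurable_normc mf.
rewrite ge0_integral_bigcup//.
- apply: HG; rewrite ?(ltW C0) ?Lnorm_ge0//.
  + by move=> k; apply: integral_ge0 => x _; rewrite lee_fin normc_ge0.
  + by move=> k; apply: HC => //; exact: scale_of_gt0.
- by move=> k; exact: measurable_annulus.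
- exact: measurable_funS mn.
- by move=> x _; rewrite lee_fin normc_ge0.
- exact: trivIset_annuli.
Qed.

Lemma extension_bigcup_annuli_le (p : \bar R) (q alpha rho : R) (n : nat) :
  (0 < d)%N -> (1 <= p)%E -> 1 <= q -> elliptic_extension d p q%:E -> 0 < rho ->
  alpha < d%:R - d.+2%:R / q - d%:R * fine p^-1%E ->
  exists2 C, 0 < C & forall P f, P \Po - 'X = P ->
    (forall i, 0 <= P`_i) -> (size P <= n)%N -> cmeasurable_fun setT f ->
    let w := rmul (fun xi => powR (Lambda P xi) (d.+2%:R / (d%:R * q))) f in
    (forall x, ~ (\bigcup_k annulus (scale_of rho k)) x -> f x = 0) ->
    (\int[lebesgue_rV d]_x (Normc.normc (w x))%:E < +oo)%E ->
  (cLnorm (spacetime_measure R d) q%:E (extension setT (radial_phase P) w) <=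
    C%:E * cLnorm (lebesgue_rV d) p (rmul (fun xi => powR (enorm xi) alpha) f))%E.
Proof.
move=> d0 p1 q1 ell r0 al.
have [C C0 HC] := annulus_estimate alpha n d0 p1 q1 ell.
have dl : 0 < d%:R - d.+2%:R / q - d%:R * fine p^-1%E - alpha by rewrite subr_gt0.
have [G G0 HG] := dyadic_series_le dl r0.
exists (2 * C * G); first by rewrite !mulr_gt0.
move=> P f evenP P0 Pn mf w f0 Iw.
have mphase := measurable_radial_phase (d := d) evenP.
have mw : cmeasurable_fun setT w.
  apply: cmeasurable_mul => //; apply: cmeasurable_real.
  by apply: (measurableT_comp (measurable_powR _)); exact: measurable_Lambda.
have mA k : measurable (@annulus R d (scale_of rho k)) by exact: measurable_annulus.
have mext U : measurable U -> cmeasurable_fun setT (extension U (radial_phase P) w).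
  by move=> mU; exact: cmeasurable_extension.
(* The factor 2 from splitting into real and imaginary parts is absorbed into the pieces, as the
   series form of Minkowski expects. *)
pose V k z := (2%:R : R)%:C * extension (annulus (scale_of rho k)) (radial_phase P) w z.
have mV k : cmeasurable_fun setT (V k).
  by apply: cmeasurable_mul; [apply: cmeasurable_real; exact: measurable_cst|exact: mext].
have nV k z : Normc.normc (V k z) =
    2 * Normc.normc (extension (annulus (scale_of rho k)) (radial_phase P) w z).
  by rewrite Normc.normcM normc_real ger0_norm.
have series := @cLnorm_series_le _ _ _ (spacetime_measure R d) _ _ V q1
  (mext _ measurableT) mV.
apply: le_trans (series _) _.
  move=> z; under eq_eseriesr do rewrite nV.
  have mF := cmeasurable_comp (cmeasurable_extension_integrand mphase mw) (measurable_pair1 z).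
  apply: normc_cintegral_bigcup_le => //.
  - exact: trivIset_annuli.
  - apply: cintegrable_normc => //.
    by under eq_integral do rewrite Normc.normcM normc_expi mul1r.
  - by move=> x /f0 wx; rewrite /w /rmul wx !mulr0.
apply: HG; rewrite ?Lnorm_ge0 ?mulr_ge0 ?(ltW C0)//.
  by move=> k; exact: Lnorm_ge0.
move=> k.
have := @cLnorm_le _ _ _ (spacetime_measure R d) q%:E 2 _ _ _ _ (mV k) (mext _ (mA k)).
rewrite lee_fin => /(_ q1 (ler0n _ _)) h.
apply: le_trans (h _) _; first by move=> z; rewrite nV.
rewrite -mulrA EFinM -muleA lee_wpmul2l// HC//; exact: scale_of_gt0.
Qed.

End dyadic_bounds.

(** * Truncation to the bounded set and conclusion *)

Section truncation.
Context {R : realType} {d : nat}.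
Implicit Types (K : set 'rV[R]_d) (f : 'rV[R]_d -> R[i]).

Lemma bounded_set_enorm K : bounded_set K ->
  exists2 rho : R, 0 < rho & forall x, K x -> enorm x < rho.
Proof.
move=> [M [_ HM]]; exists (d.+1%:R * (`|M| + 1) + 1).
  by rewrite ltr_wpDl// mulr_ge0// addr_ge0.
move=> x Kx; rewrite (le_lt_trans (enorm_le_norm x))//.
rewrite ltr_pwDr// ler_wpM2l//; apply: (HM (`|M| + 1)) => //.
by rewrite ltr_pwDr// ler_norm.
Qed.

(* The annuli miss the origin, so this is [\1_K f] only almost everywhere. *)
Definition dyadic_part (rho : R) K f : 'rV[R]_d -> R[i] :=
  rmul \1_(\bigcup_k annulus (scale_of rho k)) (rmul \1_K f).

Variables (rho : R) (K : set 'rV[R]_d).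
Hypotheses (rho0 : 0 < rho) (Krho : forall x, K x -> enorm x < rho).

Lemma dyadic_part_eq f x : x != 0 -> rmul \1_K f x = dyadic_part rho K f x.
Proof.
move=> x0; rewrite /dyadic_part {2}/rmul [\1_(\bigcup_k _) x]indicE.
have [xr|xr] := ltP (enorm x) rho.
  by rewrite mem_set ?mul1r//; apply/bigcup_annuli.
rewrite /rmul indicE memNset ?mul0r ?mulr0// => /Krho; by rewrite ltNge xr.
Qed.

Lemma dyadic_part_notin f x :
  ~ (\bigcup_k annulus (scale_of rho k)) x -> dyadic_part rho K f x = 0.
Proof. by move=> xU; rewrite /dyadic_part {1}/rmul indicE memNset// mul0r. Qed.

Lemma dyadic_part_supp f x : rho <= enorm x -> dyadic_part rho K f x = 0.
Proof.
move=> xr; apply: dyadic_part_notin => /(bigcup_annuli _ rho0)[_].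
by rewrite ltNge xr.
Qed.

Lemma normc_dyadic_part_le f x :
  Normc.normc (dyadic_part rho K f x) <= Normc.normc (f x).
Proof.
rewrite !normc_rmul !indicE !ger0_norm// mulrA ler_piMl ?normc_ge0//.
by rewrite mulr_ile1// lern1 leq_b1.
Qed.

Lemma cmeasurable_dyadic_part f : cmeasurable_fun setT (rmul \1_K f) ->
  cmeasurable_fun setT (dyadic_part rho K f).
Proof.
move=> mKf; apply: cmeasurable_mul => //; apply: cmeasurable_real.
apply: measurable_indic; apply: bigcup_measurable => k _.
exact: measurable_annulus.
Qed.

Lemma cLnorm_weight_dyadic_part_le (p : \bar R) (alpha : R) f : (1 <= p)%E ->
  cmeasurable_fun setT f -> cmeasurable_fun setT (rmul \1_K f) ->
  (cLnorm (lebesgue_rV d) p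
     (rmul (fun xi => powR (enorm xi) alpha) (dyadic_part rho K f)) <=
   cLnorm (lebesgue_rV d) p (rmul (fun xi => powR (enorm xi) alpha) f))%E.
Proof.
move=> p1 mf mKf; have mg := cmeasurable_dyadic_part mKf.
have := @cLnorm_le _ _ _ (lebesgue_rV d) p 1 _ _ p1 ler01
  (cmeasurable_weight alpha mg) (cmeasurable_weight alpha mf).
rewrite mul1e; apply=> x; rewrite mul1r !normc_rmul ler_wpM2l//.
by rewrite -!normc_rmul normc_dyadic_part_le.
Qed.

End truncation.

(** Since 2(d+1) >= d+2, the lower bound on [q] puts the dual of [pt] above 1. *)
Lemma conj_gt1 (R : realType) (d : nat) (q : R) : (0 < d)%N ->
  2 * d.+1%:R / d%:R < q -> 1 < d%:R / d.+2%:R * q.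
Proof.
move=> d0; rewrite ltr_pdivrMr ?ltr0n// => q2.
rewrite mulrAC ltr_pdivlMr ?ltr0n// mul1r [_ * q]mulrC (le_lt_trans _ q2)//.
by rewrite -natrM ler_nat; lia.
Qed.

Lemma cLnormy_le (R : realType) dT (T : measurableType dT)
    (mu : {measure set T -> \bar R}) (v : T -> R[i]) (y : \bar R) :
  (0 <= y)%E -> (forall z, (Normc.normc (v z))%:E <= y)%E ->
  (cLnorm mu +oo%E v <= y)%E.
Proof.
move=> y0 vy; rewrite /cLnorm unlock; case: ifPn => // _.
by apply/ess_supP; apply: nearW => z /=; rewrite ger0_norm ?normc_ge0.
Qed.

Theorem proposition10p2 (R : realType) (d : nat) (p q pt : \bar R) :
  (0 < d)%N ->
  (1 <= p)%E ->
  (maxe ((d.+2%:R / d%:R)%:E * hoelder_conjugate p)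
        ((2 * d.+1%:R) / d%:R)%:E < q)%E ->
  elliptic_extension d p q ->
  hoelder_conjugate pt = ((d%:R / d.+2%:R)%:E * q)%E ->
  forall (K : set 'rV[R]_d) (alpha : R) (n : nat),
    bounded_set K ->
    alpha < d%:R * fine pt^-1%E - d%:R * fine p^-1%E ->
  exists C : R, 0 < C /\
    forall P : {poly R},
      P \Po - 'X = P -> (forall i, 0 <= P`_i) -> size P = n ->
    forall f : 'rV[R]_d -> R[i],
      cmeasurable_fun setT f -> cmeasurable_fun setT (rmul \1_K f) ->
      (cLnorm (lebesgue_rV d) p
        (rmul (fun xi => powR (enorm xi) alpha) f) < +oo)%E ->
    exists v : measurableTypeR R * 'rV[R]_d -> R[i],
      (forall t : R,
        fourier_multiplier
          (fun xi => powR (Lambda P xi) (fine (hoelder_conjugate pt)^-1%E))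
          (fun x => extension setT (radial_phase P) (rmul \1_K f) (t, x))
          (fun x => v (t, x))) /\
      (cLnorm (spacetime_measure R d) q v <=
        C%:E * cLnorm (lebesgue_rV d) p
          (rmul (fun xi => powR (enorm xi) alpha) f))%E.
Proof.
move=> d0 p1; rewrite gt_max => /andP[qp q2] ell ptq K alpha n bK al.
have dR : 0 < d%:R :> R by rewrite ltr0n.
have d2R : 0 < d.+2%:R :> R by rewrite ltr0n.
(* At p = 1 the dual exponent is infinite, and the lower bound on [q] would read oo < q. *)
have {qp} p1' : (1 < p)%E.
  rewrite lt_neqAle p1 andbT; apply: contraTneq qp => <-.
  by rewrite hoelder_conjugate1 gt0_muley ?lte_fin ?divr_gt0// ltNge leey.
have [rho r0 Krho] := bounded_set_enorm bK.
set s := fine (hoelder_conjugate pt)^-1%E.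
(* From 1/pt <= 1 the condition on [alpha] implies the threshold for integrability near the origin.
   When q = oo the dual of [pt] is infinite, so 1/pt = 1 and s = 0. *)
have [s0 al1] : 0 <= s /\ alpha < d%:R - d%:R * fine p^-1%E.
  have pt1 : fine pt^-1%E <= 1 /\ 0 <= s.
    rewrite /s; move: ptq q2; case: q {ell} => [q ptq q2| |//]; last first.
      rewrite gt0_muley ?lte_fin ?divr_gt0// => pty _.
      by rewrite pty invey (hoelder_conjugate_eqy pty) inve1.
    rewrite lte_fin in q2; have x1 := conj_gt1 d0 q2.
    have x0 := lt_trans ltr01 x1.
    rewrite (inve_hoelder_conjugate x1 ptq) ptq inver gt_eqF//=.
    by rewrite invr_ge0 (ltW x0) lerBlDr lerDl invr_ge0 ltW.
  split; first by case: pt1.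
  rewrite (lt_le_trans al)// lerB// ler_piMr ?(ltW dR)//; by case: pt1.
have [C1 C10 HC1] := integral_bigcup_annuli_le p1' r0 al1.
have L1 (f : 'rV[R]_d -> R[i]) : cmeasurable_fun setT f ->
    cmeasurable_fun setT (rmul \1_K f) ->
    (\int[lebesgue_rV d]_x (Normc.normc (dyadic_part rho K f x))%:E <=
     C1%:E * cLnorm (lebesgue_rV d) p (rmul (fun xi => powR (enorm xi) alpha) f))%E.
  move=> mf mKf; apply: (@le_trans _ _ (C1%:E * cLnorm (lebesgue_rV d) p
      (rmul (fun xi => powR (enorm xi) alpha) (dyadic_part rho K f)))%E); last first.
    by rewrite lee_wpmul2l ?lee_fin ?(ltW C10)//; exact: cLnorm_weight_dyadic_part_le.
  have mg : cmeasurable_fun setT (dyadic_part rho K f) by exact: cmeasurable_dyadic_part.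
  apply: le_trans (HC1 _ mg).
  rewrite [leRHS]integral_mkcond le_eqVlt; apply/orP; left; apply/eqP.
  apply: eq_integral => x _; rewrite /patch; case: ifPn => // /negP xU.
  by rewrite dyadic_part_notin ?Normc.normc0// => /mem_set.
have mult P (f : 'rV[R]_d -> R[i]) : P \Po - 'X = P -> cmeasurable_fun setT f ->
    cmeasurable_fun setT (rmul \1_K f) ->
    (cLnorm (lebesgue_rV d) p (rmul (fun xi => powR (enorm xi) alpha) f) < +oo)%E ->
    forall t : R, fourier_multiplier (fun xi => powR (Lambda P xi) s)
      (fun x => extension setT (radial_phase P) (rmul \1_K f) (t, x))
      (fun x => extension setT (radial_phase P)
        (rmul (fun xi => powR (Lambda P xi) s) (dyadic_part rho K f)) (t, x)).
  move=> evenP mf mKf foo; apply: (fourier_multiplier_extension (rho := rho)) => //.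
  - exact: cmeasurable_dyadic_part.
  - by move=> x; exact: dyadic_part_eq.
  - by move=> x; exact: dyadic_part_supp.
  - by apply: le_lt_trans (L1 _ mf mKf) _; rewrite lte_mul_pinfty// ?lee_fin ?(ltW C10).
(* For q = oo the symbol is identically 1, also where [Lambda] vanishes since 0^0 = 1 here, and the
   extension is bounded by the L^1 norm. *)
have [qoo|qfin] := eqVneq q +oo%E.
  exists (2 * C1); split; first exact: mulr_gt0.
  move=> P evenP P0 Pn f mf mKf foo.
  exists (extension setT (radial_phase P)
    (rmul (fun xi => powR (Lambda P xi) s) (dyadic_part rho K f))); split.
    by move=> t; apply: mult.
  have s00 : s = 0 by rewrite /s ptq qoo gt0_muley ?lte_fin ?divr_gt0// invey.
  have mg : cmeasurable_fun setT (dyadic_part rho K f) by exact: cmeasurable_dyadic_part.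
  have mphase := measurable_radial_phase (d := d) evenP.
  rewrite qoo; apply: cLnormy_le => [|z].
    by rewrite mule_ge0 ?Lnorm_ge0// lee_fin mulr_ge0// ltW.
  have -> : rmul (fun xi => powR (Lambda P xi) s) (dyadic_part rho K f) = dyadic_part rho K f.
    by apply/funext => x; rewrite {1}/rmul s00 powRr0 mul1r.
  apply: le_trans (normc_cintegral_le _ (cmeasurable_comp
    (cmeasurable_extension_integrand mphase mg) (measurable_pair1 z))) _.
  under eq_integral do rewrite Normc.normcM normc_expi mul1r.
  by rewrite EFinM -muleA lee_wpmul2l//; exact: L1.
case: q qfin q2 ell ptq => [q| |] // _ q2 ell ptq.
have {}q2 : 2 * d.+1%:R / d%:R < q by rewrite lte_fin in q2.
have x1 := conj_gt1 d0 q2.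
have ptE := inve_hoelder_conjugate x1 ptq.
have q0 : 0 < q by rewrite (lt_trans _ q2)// divr_gt0// mulr_gt0.
have sE : s = d.+2%:R / (d%:R * q).
  rewrite /s ptq inver gt_eqF ?(lt_trans ltr01)//=.
  by rewrite invfM invf_div -mulrA -invfM.
have q1 : 1 <= q.
  rewrite ltW// (lt_trans x1)// gtr_pMl// ltr_pdivrMr// mul1r ltr_nat.
  exact: ltnW.
have [|C C0 HC] := @extension_bigcup_annuli_le R d p q alpha rho n d0 p1 q1 ell r0.
  move: al; rewrite ptE /=; congr (_ < _ - _).
  by rewrite invfM invf_div; field; rewrite !gt_eqF.
exists C; split=> // P evenP P0 Pn f mf mKf foo.
exists (extension setT (radial_phase P)
  (rmul (fun xi => powR (Lambda P xi) s) (dyadic_part rho K f))); split.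
  by move=> t; apply: mult.
have mg : cmeasurable_fun setT (dyadic_part rho K f) by exact: cmeasurable_dyadic_part.
have goo : (\int[lebesgue_rV d]_x (Normc.normc (dyadic_part rho K f x))%:E < +oo)%E.
  by apply: le_lt_trans (L1 _ mf mKf) _; rewrite lte_mul_pinfty// ?lee_fin ?(ltW C10).
apply: (@le_trans _ _ (C%:E * cLnorm (lebesgue_rV d) p
    (rmul (fun xi => powR (enorm xi) alpha) (dyadic_part rho K f)))%E); last first.
  by rewrite lee_wpmul2l ?lee_fin ?(ltW C0)//; exact: cLnorm_weight_dyadic_part_le.
rewrite sE; apply: HC => //.
- by rewrite Pn.
- by move=> x; exact: dyadic_part_notin.
- rewrite -sE; apply: (integral_normc_Lambda_lty (rho := rho)) => //.
  by move=> x; exact: dyadic_part_supp.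
Qed.
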